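(* Let $X=\mathbb{R}^n/\Lambda$ be a tropical torus and let $L=L(Q,\alpha)$ be a tropical line bundle on $X$ such that $Q=c_1(L)$ is positive semidefinite. Let $q:\Lambda\to(\mathbb{Z}^n)^*$ be the linear map $\lambda\mapsto Q(\lambda,\cdot)$ and $q_{\mathbb{R}}:\mathbb{R}^n\to(\mathbb{R}^n)^*$ its linear extension. (1) If $\alpha\in\operatorname{Im}(q_{\mathbb{R}})+(\mathbb{Z}^n)^*$, then $\Gamma(X,L)$ is generated as a $\mathbb{T}$-module by $l=\left|\text{the torsion part of }\operatorname{Cok}(q)\right|$ elements, and $\Gamma(X,L)$ embeds into $\mathbb{T}^l$ via the map $\varphi$ described in the context. Moreover, via $\varphi$, $\Gamma(X,L)$ is identified with an $l$-dimensional convex polyhedron in $\mathbb{T}^l$, and its projectivization is identified with a compact polyhedron in $\mathbb{R}^{l-1}$. (2) If $\alpha\notin\operatorname{Im}(q_{\mathbb{R}})+(\mathbb{Z}^n)^*$, then $\Gamma(X,L)=\{-\infty\}$.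
   Context: $\mathbb{T}=\mathbb{R}\cup\{-\infty\}$ with tropical sum $\max$ and tropical product $+$. A tropical torus is $X=\mathbb{R}^n/\Lambda$ with $\Lambda\subset\mathbb{R}^n$ a lattice of rank $n$; its integral affine structure comes from the standard lattice $\mathbb{Z}^n$. A real-valued regular function is a continuous function that is locally a maximum of finitely many functions $x\mapsto a\cdot x+c$ with $a\in(\mathbb{Z}^n)^*$, $c\in\mathbb{R}$. For a bilinear form $Q:\Lambda\times\mathbb{Z}^n\to\mathbb{Z}$ whose $\mathbb{R}$-bilinear extension $Q_{\mathbb{R}}$ to $\mathbb{R}^n\times\mathbb{R}^n$ is symmetric, and $\alpha\in(\mathbb{R}^n)^*$, $L(Q,\alpha)$ is the tropical line bundle on $X$ obtained as the quotient of $\mathbb{R}^n\times\mathbb{T}$ by the $\Lambda$-action $\lambda\cdot(x,t)=(x+\lambda,\ t+Q_{\mathbb{R}}(\lambda,x)+\tfrac12Q_{\mathbb{R}}(\lambda,\lambda)+\alpha(\lambda))$; its Chern class $c_1(L(Q,\alpha))$ is $Q$. (Semi)definiteness refers to $Q_{\mathbb{R}}$. $\operatorname{Cok}(q)=(\mathbb{Z}^n)^*/q(\Lambda)$. $\Gamma(X,L(Q,\alpha))$, the $\mathbb{T}$-module of global regular sections, is the set of theta functions, i.e. regular functions $\Theta:\mathbb{R}^n\to\mathbb{R}$ with $\Theta(x+\lambda)=\Theta(x)+Q_{\mathbb{R}}(\lambda,x)+\tfrac12Q_{\mathbb{R}}(\lambda,\lambda)+\alpha(\lambda)$ for all $\lambda\in\Lambda$,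 $x\in\mathbb{R}^n$, together with $-\infty$. It is generated by $g_1,\dots,g_l$ if each element is of the form $\max_i\{g_i+s_i\}$ with $s_i\in\mathbb{T}$. Its projectivization is $(\Gamma\setminus\{-\infty\})/\sim$ with $\Theta\sim\Theta+t$, $t\in\mathbb{R}$. The map $\varphi$ in case (1): write $\alpha=q_{\mathbb{R}}(r)+\gamma$ with $r\in\mathbb{R}^n$, $\gamma\in(\mathbb{Z}^n)^*$; $\Theta\mapsto\Theta-\gamma$ identifies $\Gamma(X,L(Q,\alpha))$ with $\Gamma(X,L(Q,q_{\mathbb{R}}(r)))$, so take $\alpha=q_{\mathbb{R}}(r)$. Let $B\subset\operatorname{Im}(q_{\mathbb{R}})\cap(\mathbb{Z}^n)^*$ be a set of representatives of $(\operatorname{Im}(q_{\mathbb{R}})\cap(\mathbb{Z}^n)^* )/q(\Lambda)$, which is the torsion part of $\operatorname{Cok}(q)$, so $|B|=l$ and $\mathbb{T}^l=\mathbb{T}^B$. For $b\in B$ choose $c_b\in\mathbb{R}^n$ with $q_{\mathbb{R}}(c_b)=b$ and put $$\Theta_b(x)=\max_{\lambda\in\Lambda}\{(b+q(\lambda))\cdot x-\tfrac12Q_{\mathbb{R}}(\lambda+c_b-r,\lambda+c_b-r)\}$$ (a theta function, independent of the choice of $c_b$). Define $\varphi(\Theta)=(\varphi^b(\Theta))_{b\in B}$ with $\varphi^b(\Theta)=\min_{x\in\mathbb{R}^n}\{\Theta(x)-\Theta_b(x)\}$, and $\varphi(-\infty)=(-\infty,\dots,-\infty)$. ''Embeds''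 means $\varphi$ is injective (the topology on $\Gamma(X,L)$ is the one induced by $\varphi$); ''identified with an $l$-dimensional convex polyhedron in $\mathbb{T}^l$'' means that $\varphi(\Gamma(X,L)\setminus\{-\infty\})\subset\mathbb{R}^l$ is an $l$-dimensional finite intersection of closed half-spaces; since $\varphi(\Theta+t)=\varphi(\Theta)+(t,\dots,t)$, the projectivization is identified with the image of this set in $\mathbb{R}^l/\mathbb{R}(1,\dots,1)\cong\mathbb{R}^{l-1}$ (equivalently, with its slice where one fixed coordinate is $0$). *)

(* Defs.v *)
From mathcomp Require Import all_boot all_order all_algebra.
From mathcomp Require Import all_classical all_reals all_analysis.
Import Order.TTheory GRing.Theory Num.Theory.
Import numFieldNormedType.Exports.
Set Implicit Arguments.
Unset Strict Implicit.
Unset Printing Implicit Defensive.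
Local Open Scope classical_set_scope.
Local Open Scope ring_scope.

(* [R^n] and [(R^n)^*] are both [ 'rV[R]_n ], paired by [dot]; [Z^n] and
   [(Z^n)^*] are both [ 'rV[int]_n ], embedded in the former by [intv].
   The tropical semifield is [ \bar R ] without [+oo]. *)

Section TropicalTheta.
Variables (R : realType) (n : nat).
Implicit Types (Lam : set 'rV[R]_n) (Q : 'rV[R]_n -> 'rV[int]_n -> int).
Implicit Types (S : 'M[R]_n).

Definition dot (a x : 'rV[R]_n) : R := \sum_(i < n) a 0 i * x 0 i.

Definition intv (m : 'rV[int]_n) : 'rV[R]_n := map_mx intr m.

Definition is_lattice Lam : Prop :=
  exists2 P : 'M[R]_n, P \in unitmx & Lam = range (fun m => intv m *m P).

(* Only the values of [Q] on [Lam] are meaningful. *)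
Definition zbilinear Lam Q : Prop :=
  (forall l1 l2 m, Lam l1 -> Lam l2 -> Q (l1 + l2) m = Q l1 m + Q l2 m) /\
  (forall l m1 m2, Lam l -> Q l (m1 + m2) = Q l m1 + Q l m2).

Definition qR S (x : 'rV[R]_n) : 'rV[R]_n := x *m S.

Definition QR S (x y : 'rV[R]_n) : R := dot (qR S x) y.

(* As [Lam] and [Z^n] span [R^n], [S] is determined by [Q]: it is the Gram
   matrix, in the standard basis, of the real bilinear extension of [Q]. *)
Definition real_extension Lam Q S : Prop :=
  forall l m, Lam l -> QR S l (intv m) = (Q l m)%:~R.

Definition qZ Q (l : 'rV[R]_n) : 'rV[int]_n := \row_j Q l (delta_mx 0 j).

Definition Cok_class Lam Q (m : 'rV[int]_n) : set 'rV[int]_n :=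
  [set m' | (qZ Q @` Lam) (m' - m)].

Definition Cok_torsion Lam Q : set (set 'rV[int]_n) :=
  [set Cok_class Lam Q m | m in
    [set m | exists2 k : nat, (0 < k)%N & (qZ Q @` Lam) (m *+ k)]].

Definition regular (f : 'rV[R]_n -> R) : Prop :=
  continuous f /\
  forall x0 : 'rV[R]_n, exists (k : nat) (a : 'I_k -> 'rV[int]_n) (c : 'I_k -> R),
    \forall x \near nbhs x0,
      (f x)%:E = \big[maxe/-oo%E]_(i < k) (dot (intv (a i)) x + c i)%:E.

Definition theta_function Lam S (alpha : 'rV[R]_n) (f : 'rV[R]_n -> R) : Prop :=
  regular f /\
  forall l x, Lam l ->
    f (x + l) = f x + QR S l x + 2^-1 * QR S l l + dot alpha l.

(* [Gamma(X, L(Q, alpha))] without the section [-oo] *)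
Definition finite_sections Lam S (alpha : 'rV[R]_n) : set ('rV[R]_n -> \bar R) :=
  [set EFin \o f | f in theta_function Lam S alpha].

Definition sections Lam S (alpha : 'rV[R]_n) : set ('rV[R]_n -> \bar R) :=
  finite_sections Lam S alpha `|` [set cst -oo%E].

Definition generates (G : set ('rV[R]_n -> \bar R)) (l : nat)
    (g : 'I_l -> 'rV[R]_n -> \bar R) : Prop :=
  (forall i, G (g i)) /\
  forall f, G f -> exists2 s : 'I_l -> \bar R, (forall i, s i != +oo%E) &
    f = fun x => \big[maxe/-oo%E]_(i < l) (g i x + s i)%E.

Definition shift_class (f : 'rV[R]_n -> \bar R) : set ('rV[R]_n -> \bar R) :=
  [set g | exists t : R, g = fun x => (f x + t%:E)%E].

Definition projectivization (G : set ('rV[R]_n -> \bar R)) :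
    set (set ('rV[R]_n -> \bar R)) :=
  [set shift_class f | f in G `\ cst -oo%E].

Definition is_representatives Lam Q S (l : nat) (b : 'I_l -> 'rV[int]_n) : Prop :=
  (forall i, range (qR S) (intv (b i))) /\
  forall m, range (qR S) (intv m) -> exists! i, (qZ Q @` Lam) (m - b i).

Definition theta_term Q S (r : 'rV[R]_n) (b : 'rV[int]_n) (c x l : 'rV[R]_n) : R :=
  dot (intv (b + qZ Q l)) x - 2^-1 * QR S (l + c - r) (l + c - r).

Definition theta_b Lam Q S (r : 'rV[R]_n) (b : 'rV[int]_n) (c x : 'rV[R]_n) :
    \bar R :=
  ereal_sup [set (theta_term Q S r b c x l)%:E | l in Lam].

Definition phi_term Lam Q S (r : 'rV[R]_n) (gamma b : 'rV[int]_n)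
    (c : 'rV[R]_n) (f : 'rV[R]_n -> \bar R) (x : 'rV[R]_n) : \bar R :=
  (f x - (dot (intv gamma) x)%:E - theta_b Lam Q S r b c x)%E.

Definition phi Lam Q S (r : 'rV[R]_n) (gamma : 'rV[int]_n) (l : nat)
    (b : 'I_l -> 'rV[int]_n) (c : 'I_l -> 'rV[R]_n)
    (f : 'rV[R]_n -> \bar R) : 'rV[\bar R]_l :=
  \row_i ereal_inf (range (phi_term Lam Q S r gamma (b i) (c i) f)).

End TropicalTheta.

Section Polyhedra.
Variables (R : realType) (d : nat).

Definition closed_halfspace (H : set 'rV[R]_d) : Prop :=
  exists2 a : 'rV[R]_d, a != 0 & exists c : R, H = [set x | dot a x <= c].

Definition polyhedron (P : set 'rV[R]_d) : Prop :=
  exists (k : nat) (H : 'I_k -> set 'rV[R]_d),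
    (forall i, closed_halfspace (H i)) /\ P = \bigcap_i H i.

(* [P] is nonempty and [k] is the dimension of its affine hull [x + U], with
   [U] (encoded by its row space) the linear span of [P - x]. *)
Definition affine_dim (P : set 'rV[R]_d) (k : nat) : Prop :=
  exists x (U : 'M[R]_d),
    [/\ P x, (forall y, P y -> (y - x <= U)%MS),
        (forall V : 'M[R]_d, (forall y, P y -> (y - x <= V)%MS) -> (U <= V)%MS)
      & \rank U = k].

(* The isomorphism from [R^d / R(1, ..., 1)] to [R^(d-1)] that normalizes
   coordinate [i] to [0] and then deletes it. *)
Definition proj_coord (i : 'I_d) (s : 'rV[R]_d) : 'rV[R]_d.-1 :=
  col' i (s - const_mx (s 0 i)).

End Polyhedra.

(* Main.v *)
Require Import Defs.
From mathcomp Require Import all_boot all_order all_algebra.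
From mathcomp Require Import all_classical all_reals all_analysis.
From mathcomp Require Import ring lra zify.
Import Order.TTheory GRing.Theory Num.Theory.
Import numFieldNormedType.Exports.
Set Implicit Arguments.
Unset Strict Implicit.
Unset Printing Implicit Defensive.
Local Open Scope classical_set_scope.
Local Open Scope ring_scope.

(* Write [M] for the integral vectors in the image of [qR S]. By periodicity of
   [f x - (1/2) Q(x, x) - alpha . x], a theta function [f] grows along [ker S]
   exactly like [alpha]; as [f] is supported at every point by an affine function
   with integral slope [a], this forces [alpha - a] into the image of [qR S], which
   is part (2). In part (1), after removing [gamma], the slopes lie in [M], and
   quasi-periodicity turns a support of slope [a] into supports of all slopes
   [a + q(lam)], i.e. into a support by [Theta_b] plus a constant, [b] the class of
   [a]. Hence [f = max_b (Theta_b + phi^b(f))], and a vector [s] occurs as [phi(f)]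
   iff every [Theta_b + s_b] is dominant somewhere. Modulo [Lam] such a
   point can be sought in a fixed box where [Theta_b] has slope [b], and there the
   quadratic decay of the coefficients of [Theta_b] leaves only finitely many
   inequalities, linear in [s] and the point; Fourier-Motzkin elimination of the
   point yields a polyhedron. It contains a neighbourhood of [0], since at
   [s = 0] the slope [b] dominates strictly at [c_b - r], and it is bounded modulo
   [R(1, ..., 1)] because the periodic functions [Theta_b - Theta_b'] are bounded. *)

(** * Pairings and positive semidefinite forms *)

Section Dot.
Variables (R : realType) (n : nat).
Implicit Types (a b x y : 'rV[R]_n) (m : 'rV[int]_n).

Lemma dotDl a b x : dot (a + b) x = dot a x + dot b x.
Proof. by rewrite /dot -big_split; apply: eq_bigr => i _; rewrite mxE mulrDl. Qed.

Lemma dotC a x : dot a x = dot x a.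
Proof. by apply: eq_bigr => i _; rewrite mulrC. Qed.

Lemma dotZl k a x : dot (k *: a) x = k * dot a x.
Proof. by rewrite /dot mulr_sumr; apply: eq_bigr => i _; rewrite mxE mulrA. Qed.

Lemma dotNl a x : dot (- a) x = - dot a x.
Proof. by rewrite -scaleN1r dotZl mulN1r. Qed.

Lemma dotBl a b x : dot (a - b) x = dot a x - dot b x.
Proof. by rewrite dotDl dotNl. Qed.

Lemma dot0l x : dot 0 x = 0.
Proof. by rewrite -(scale0r 0) dotZl mul0r. Qed.

Lemma dotDr a x y : dot a (x + y) = dot a x + dot a y.
Proof. by rewrite !(dotC a) dotDl. Qed.

Lemma dotZr k a x : dot a (k *: x) = k * dot a x.
Proof. by rewrite !(dotC a) dotZl. Qed.

Lemma dotBr a x y : dot a (x - y) = dot a x - dot a y.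
Proof. by rewrite !(dotC a) dotBl. Qed.

Lemma dot_delta a i : dot a (delta_mx 0 i) = a 0 i.
Proof.
rewrite /dot (bigD1 i) //= mxE !eqxx mulr1 big1 ?addr0 // => j ji.
by rewrite mxE (negbTE ji) andbF mulr0.
Qed.

Lemma ler_norm_dot a x T : (forall i, `|x 0 i| <= T) ->
  `|dot a x| <= (\sum_i `|a 0 i|) * T.
Proof.
move=> xT; rewrite (le_trans (ler_norm_sum _ _ _))// mulr_suml ler_sum// => i _.
by rewrite normrM ler_wpM2l.
Qed.

Lemma intv0 : intv R (0 : 'rV_n) = 0.
Proof. exact: map_mx0. Qed.

Lemma intvD m m' : intv R (m + m') = intv R m + intv R m'.
Proof. exact: map_mxD. Qed.

Lemma intvN m : intv R (- m) = - intv R m.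
Proof. exact: map_mxN. Qed.

Lemma intvB m m' : intv R (m - m') = intv R m - intv R m'.
Proof. exact: map_mxB. Qed.

Lemma intv_inj : injective (@intv R n).
Proof.
move=> m m' /matrixP e; apply/matrixP => i j; have := e i j.
by rewrite !mxE => /intr_inj.
Qed.

End Dot.

Section PositiveForm.
Variables (R : realType) (n : nat) (S : 'M[R]_n).
Implicit Types (x y z : 'rV[R]_n).

Lemma QRDl x y z : QR S (x + y) z = QR S x z + QR S y z.
Proof. by rewrite /QR /qR mulmxDl dotDl. Qed.
Lemma QRZl k x z : QR S (k *: x) z = k * QR S x z.
Proof. by rewrite /QR /qR -scalemxAl dotZl. Qed.
Lemma QRDr x y z : QR S x (y + z) = QR S x y + QR S x z.
Proof. exact: dotDr. Qed.
Lemma QRZr k x z : QR S x (k *: z) = k * QR S x z.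
Proof. exact: dotZr. Qed.
Lemma QRNl x z : QR S (- x) z = - QR S x z.
Proof. by rewrite -scaleN1r QRZl mulN1r. Qed.
Lemma QRNr x z : QR S x (- z) = - QR S x z.
Proof. by rewrite -scaleN1r QRZr mulN1r. Qed.

Definition QRE := (QRDl, QRDr, QRNl, QRNr).

Hypothesis S_sym : forall x y, QR S x y = QR S y x.
Hypothesis S_psd : forall x, 0 <= QR S x x.

Lemma QR_ker x y z : qR S x = qR S y -> QR S x z = QR S y z.
Proof. by rewrite /QR => ->. Qed.

(* Cauchy-Schwarz for [QR S] against the basis vectors. *)
Lemma psd_coercive : exists2 k : R, 0 < k &
  forall z, k * (\sum_i (qR S z) 0 i ^+ 2) <= QR S z z.
Proof.
pose e i : 'rV[R]_n := delta_mx 0 i.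
pose t : R := 1 + \sum_i QR S (e i) (e i).
have s0 : 0 <= \sum_i QR S (e i) (e i) by apply: sumr_ge0.
have t0 : 0 < t by rewrite /t; lra.
have et i : QR S (e i) (e i) <= t.
  rewrite /t (bigD1 i)//=.
  have : 0 <= \sum_(j | j != i) QR S (e j) (e j) by apply: sumr_ge0.
  lra.
(* The [n] coordinatewise bounds [cs] are summed; [n.+1] in place of [n] keeps the constant positive
   when [n = 0], and the summand 1 in [t] does so when [S = 0]. *)
exists ((n.+1%:R * t)^-1); first by rewrite invr_gt0 mulr_gt0.
move=> z; rewrite ler_pdivrMl ?mulr_gt0//.
have cs i : (qR S z) 0 i ^+ 2 <= t * QR S z z.
  set v := (qR S z) 0 i.
  have zv : QR S z (e i) = v by rewrite /QR dot_delta.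
  have := S_psd (z - (v / t) *: e i).
  rewrite !QRE !QRZl !QRZr (S_sym (e i) z) zv => h.
  have h2 : (v / t) ^+ 2 * QR S (e i) (e i) <= (v / t) ^+ 2 * t.
    by rewrite ler_wpM2l ?sqr_ge0.
  have h3 : (v / t) ^+ 2 * t = v ^+ 2 / t by field; rewrite gt_eqF.
  have h4 : v / t * v = v ^+ 2 / t by field; rewrite gt_eqF.
  have : v ^+ 2 / t <= QR S z z by lra.
  by rewrite ler_pdivrMr// mulrC.
apply: (@le_trans _ _ (\sum_(i < n) t * QR S z z)); first exact: ler_sum.
rewrite sumr_const card_ord -[leLHS]mulr_natl -mulrA ler_wpM2r ?mulr_ge0 ?(ltW t0)//.
by rewrite ler_nat.
Qed.

(** The row space of a symmetric matrix is the orthogonal complement of its kernel: by symmetry the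
    columns of [cokermx S] lie in the kernel, and orthogonality to them is the criterion [submxE]
    for the row space. *)
Lemma sub_qR_ortho u : (forall v, qR S v = 0 -> dot u v = 0) -> exists y, u = qR S y.
Proof.
move=> uv; suff /submxP[y uy] : (u <= S)%MS by exists y.
have symT : S^T = S.
  apply/matrixP => i j; rewrite mxE.
  have := S_sym (delta_mx 0 j) (delta_mx 0 i).
  by rewrite /QR /qR !dot_delta -!rowE !mxE.
rewrite submxE; apply/eqP/matrixP => i j; rewrite ord1 [RHS]mxE.
have K0 : (cokermx S)^T *m S = 0.
  by rewrite -[X in _ *m X]symT -trmx_mul mulmx_coker trmx0.
have := uv (row j (cokermx S)^T).
rewrite /qR -row_mul K0 row0 => /(_ erefl) <-.
by rewrite /dot mxE; apply: eq_bigr => k _; rewrite !mxE.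
Qed.

End PositiveForm.

(** * Regular functions and maxima of coercive families *)

Section Support.
Variables (R : realType).

(* A negative value [g 1] would make [g t - t * g 1], after adding a small
   multiple of [t ^+ 2 - t], attain a positive maximum inside [`]0, 1[],
   where the perturbed function has a strictly convex local minorant. *)
Lemma locally_supported_ge0 (g : R -> R) :
  continuous g ->
  (forall t, exists s, \forall u \near t, g t + s * (u - t) <= g u) ->
  g 0 = 0 -> (\forall u \near (0 : R), 0 <= g u) -> 0 <= g 1.
Proof.
move=> gc gs g0 gp; rewrite leNgt; apply/negP => g1.
pose h (t : R) := g t - t * g 1 - (g 1 / 2) * (t ^+ 2 - t).
have hc : continuous h.
  move=> t; apply: cvgB; first apply: cvgB; first exact: gc.
    by apply: cvgMl; exact: cvg_id.
  apply: cvgMr; apply: cvgB; last exact: cvg_id.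
  by rewrite expr2; under eq_fun do rewrite expr2; apply: cvgM; exact: cvg_id.
have [c /[!in_itv]/= /andP[c0 c1] cmax] := EVT_max ler01 (continuous_subspaceT hc).
have /nbhs_ballP[d /= d0 dP] := gp.
pose t0 := Num.min (d / 2) (1 / 2).
have t00 : 0 < t0 by rewrite lt_min; apply/andP; split; lra.
have t0d : t0 <= d / 2 by rewrite ge_min lexx.
have t01 : t0 <= 1 / 2 by rewrite ge_min lexx orbT.
have gt0 : 0 <= g t0.
  by apply: dP; rewrite /ball/= sub0r normrN gtr0_norm//; lra.
have ht0 : 0 < h t0.
  have : 0 < - g 1 * t0 * (1 + t0) by rewrite !mulr_gt0//; lra.
  rewrite /h; nra.
have hcp : 0 < h c.
  by apply: lt_le_trans ht0 _; apply: cmax; rewrite in_itv/=; apply/andP; split; lra.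
have c0' : 0 < c.
  rewrite lt_neqAle c0 andbT; apply/eqP => e; move: hcp.
  by rewrite /h -e g0; lra.
have c1' : c < 1.
  rewrite lt_neqAle c1 andbT; apply/eqP => e; move: hcp.
  by rewrite /h e; lra.
have [s] := gs c; move=> /nbhs_ballP[e /= e0 eP].
pose q := Num.min (e / 2) (Num.min c (1 - c)).
have q0 : 0 < q by rewrite !lt_min; apply/and3P; split; lra.
have [qe qc q1] : [/\ q <= e / 2, q <= c & q <= 1 - c].
  by rewrite /q; split; rewrite !ge_min lexx ?orbT.
have up : g c + s * ((c + q) - c) <= g (c + q).
  by apply: eP; rewrite /ball/= opprD addrA subrr sub0r normrN gtr0_norm//; lra.
have dn : g c + s * ((c - q) - c) <= g (c - q).
  by apply: eP; rewrite /ball/= opprB addrC subrK gtr0_norm//; lra.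
have hup : h (c + q) <= h c by apply: cmax; rewrite in_itv/=; apply/andP; split; lra.
have hdn : h (c - q) <= h c by apply: cmax; rewrite in_itv/=; apply/andP; split; lra.
(* Adding the supports at [c + q] and [c - q] cancels the slope [s], while the quadratic term gains
   [- g 1 * q ^+ 2], so [h] exceeds [h c] at one of the two points. *)
have : 0 < - g 1 * q ^+ 2 by rewrite mulr_gt0 ?exprn_gt0//; lra.
rewrite /h in hup hdn; nra.
Qed.

Lemma bigmaxe_attained k (F : 'I_k -> R) (y : R) :
  y%:E = \big[maxe/-oo%E]_(i < k) (F i)%:E -> exists i, y = F i.
Proof.
have : \big[maxe/-oo%E]_(i < k) (F i)%:E = -oo%E \/
    exists i, \big[maxe/-oo%E]_(i < k) (F i)%:E = (F i)%:E.
  apply: (big_ind (fun z => z = -oo%E \/ exists i, z = (F i)%:E)).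
  - by left.
  - move=> a b [->|[i ->]] [->|[j ->]]; rewrite ?maxNye ?maxeNy; [by left|right..].
    + by exists j.
    + by exists i.
    + by rewrite maxEle; case: ifP => _; [exists j | exists i].
  - by move=> i _; right; exists i.
by move=> [-> //|[i ->] [->]]; exists i.
Qed.

Lemma bigmaxeP k (F : 'I_k -> \bar R) (y : R) :
  (forall i, (F i <= y%:E)%E) -> (exists i, F i = y%:E) ->
  y%:E = \big[maxe/-oo%E]_(i < k) F i.
Proof.
move=> Fy [i Fi]; apply/eqP; rewrite eq_le; apply/andP; split.
  by rewrite -Fi le_bigmax.
by apply: bigmax_le => //; rewrite leNye.
Qed.

Variable n : nat.
Implicit Types (x v : 'rV[R]_n).

Lemma near_segment (x v : 'rV[R]_n) (A : set 'rV[R]_n) : nbhs x A ->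
  exists2 d : R, 0 < d & forall t, `|t| < d -> A (x + t *: v).
Proof.
move=> nA; have : (fun t : R => x + t *: v) @ (0 : R) --> x.
  rewrite -[in X in _ --> X](addr0 x) -(scale0r v).
  by apply: cvgD; [exact: cvg_cst | apply: cvgZr_tmp; exact: cvg_id].
move=> /(_ _ nA)/nbhs_ballP[d /= d0 dA]; exists d => // t td.
by apply: dA; rewrite /ball/= sub0r normrN.
Qed.
Lemma regular_local_support (f : 'rV[R]_n -> R) x0 : regular f ->
  exists m, \forall x \near x0, f x0 + dot (intv R m) (x - x0) <= f x.
Proof.
move=> [_ /(_ x0)[k [a [c fE]]]].
have [i fi] := bigmaxe_attained (nbhs_singleton fE).
exists (a i); apply: filterS fE => x fx.
rewrite -lee_fin fx (le_trans _ (le_bigmax _ _ i))// lee_fin fi dotBr; lra.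
Qed.

(** Local supports globalize by convexity along segments: on the segment from [x0] to [x], the
    excess [g] of [f] over the local support at [x0] is itself locally supported everywhere and
    nonnegative near 0, hence nonnegative at 1. *)
Lemma regular_support (f : 'rV[R]_n -> R) x0 : regular f ->
  exists m, forall x, f x0 + dot (intv R m) (x - x0) <= f x.
Proof.
move=> fr; have [m mP] := regular_local_support x0 fr; exists m => x.
pose v := x - x0.
pose g (t : R) := f (x0 + t *: v) - f x0 - t * dot (intv R m) v.
suff : 0 <= g 1.
  by rewrite /g scale1r {1}/v addrCA subrr addr0 mul1r => h; lra.
apply: locally_supported_ge0.
- move=> t; apply: cvgB; last by apply: cvgMl; exact: cvg_id.
  apply: cvgB; last exact: cvg_cst.
  have line : x0 + u *: v @[u --> t] --> x0 + t *: v.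
    by apply: cvgD; [exact: cvg_cst | apply: cvgZr_tmp; exact: cvg_id].
  exact: cvg_comp line (fr.1 _).
- move=> t; have [m' m'P] := regular_local_support (x0 + t *: v) fr.
  exists (dot (intv R m') v - dot (intv R m) v).
  have [d d0 dP] := near_segment v m'P.
  apply/nbhs_ballP; exists d => // u; rewrite /ball/= => tu.
  have := dP (u - t); rewrite distrC => /(_ tu).
  rewrite [_ + _ - (_ + _)]addrAC subrr add0r dotZr -addrA -scalerDl.
  rewrite (_ : t + (u - t) = u); last by ring.
  by rewrite /g; lra.
- by rewrite /g scale0r addr0 mul0r; lra.
- have [d d0 dP] := near_segment v mP.
  apply/nbhs_ballP; exists d => // u; rewrite /ball/= sub0r normrN => ud.
  by have := dP u ud; rewrite [_ + _ - _]addrAC subrr add0r dotZr /g; lra.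
Qed.

End Support.

Section Box.
Variables (R : realType) (n : nat).
Implicit Types (m : 'rV[int]_n) (x : 'rV[R]_n).

Lemma exists_nat_ge (y : R) : exists N : nat, y <= N%:R.
Proof.
exists (Num.bound `|y|).
exact: le_trans (ler_norm y) (ltW (archi_boundP (normr_ge0 y))).
Qed.

Lemma int_box_finite (N : nat) : exists L : seq 'rV[int]_n,
  forall m : 'rV[int]_n, \sum_i `|(intv R m) 0 i| <= N%:R -> m \in L.
Proof.
exists [seq \row_i ((f i : nat)%:Z - N%:Z) | f : {ffun 'I_n -> 'I_(N + N).+1}].
move=> m mN.
have mi i : `|m 0 i| <= N%:Z.
  rewrite -(ler_int R) intr_norm; apply: le_trans mN.
  rewrite (bigD1 i)//= mxE lerDl; exact: sumr_ge0.
have mi' i : (absz (m 0 i + N%:Z)%R < (N + N).+1)%N.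
  have := mi i; rewrite ler_norml => /andP[h1 h2].
  rewrite ltnS -lez_nat gez0_abs; last by lia.
  by rewrite PoszD lerD2r.
apply/mapP; exists [ffun i => Ordinal (mi' i)]; first by rewrite mem_enum.
apply/rowP => i; rewrite !mxE ffunE /= gez0_abs ?addrK//.
by have := mi i; rewrite ler_norml => /andP[h1 h2]; lia.
Qed.

Lemma exists_argmax (T : eqType) (f : T -> R) (L : seq T) (t : T) : t \in L ->
  exists2 x : T, x \in L & forall y, y \in L -> f y <= f x.
Proof.
elim: L t => // a L IH t _; case: L IH => [|b L] IH.
  by exists a; rewrite ?inE// => y; rewrite inE => /eqP ->.
have [x xL xP] := IH b (mem_head _ _).
have [fxa|fax] := leP (f x) (f a).
  exists a; rewrite ?mem_head// => y; rewrite inE => /orP[/eqP -> //|/xP].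
  by move=> /le_trans; apply.
exists x; first by rewrite inE xL orbT.
by move=> y; rewrite inE => /orP[/eqP ->|/xP //]; exact: ltW.
Qed.

Definition max_of (A : set 'rV[int]_n) (w : 'rV[int]_n -> R) (F : 'rV[R]_n -> R) :=
  (forall m x, A m -> dot (intv R m) x + w m <= F x) /\
  forall x, exists2 m, A m & F x = dot (intv R m) x + w m.

(** Over a bounded box the affine functions of the family sink at least as fast as the l1-norm of
    their slope grows, so only finitely many of them compete for the maximum there. *)
Definition coercive (A : set 'rV[int]_n) (w : 'rV[int]_n -> R) :=
  forall T, exists E, forall m x, A m -> (forall i, `|x 0 i| <= T) ->
    dot (intv R m) x + w m <= E - \sum_i `|(intv R m) 0 i|.

Lemma near_box (x0 : 'rV[R]_n) : \forall x \near x0, forall i : 'I_n,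
  `|(x : 'rV_n) 0 i| <= (\sum_j `|x0 0 j|) + 1.
Proof.
apply/nbhs_ballP; exists 1 => //= x [_ xb] i.
have := xb 0 i; rewrite /ball/= => h.
have : `|x0 0 i| <= \sum_j `|x0 0 j|.
  by rewrite (bigD1 i)//= lerDl; exact: sumr_ge0.
have := ler_normB (x0 0 i) (x0 0 i - x 0 i).
by rewrite opprB addrCA subrr addr0; lra.
Qed.

Lemma coercive_active A w : A !=set0 -> coercive A w -> forall T, exists N : nat,
  forall m x, A m -> (forall i, `|x 0 i| <= T) ->
   (forall m', A m' -> dot (intv R m') x + w m' <= dot (intv R m) x + w m) ->
   \sum_i `|(intv R m) 0 i| <= N%:R.
Proof.
move=> [m0 Am0] cA T; have [E EP] := cA T.
(* An active slope must do at least as well as the fixed competitor [m0], whose value on the box is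
   at least [w m0] minus the l1-norm of [m0] times [T]. *)
pose B := E - w m0 + (\sum_i `|(intv R m0) 0 i|) * T.
have [N NB] := exists_nat_ge B; exists N => m x Am xT mx.
have := EP _ _ Am xT; have := mx _ Am0.
have := ler_norm_dot (intv R m0) xT; rewrite ler_norml => /andP[h1 _] h2 h3.
have : \sum_i `|(intv R m) 0 i| <= B by rewrite /B; lra.
by move=> /le_trans; apply.
Qed.

Lemma max_of_exists A w : A !=set0 -> coercive A w -> exists F, max_of A w F.
Proof.
move=> A0 cA.
have mP x : exists m, A m /\
    forall m', A m' -> dot (intv R m') x + w m' <= dot (intv R m) x + w m.
  have [m0 Am0] := A0.
  pose T := \sum_j `|x 0 j|.
  have xT i : `|x 0 i| <= T.
    by rewrite /T (bigD1 i)//= lerDl; exact: sumr_ge0.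
  have [E EP] := cA T.
  pose B := E - (dot (intv R m0) x + w m0).
  have [N NB] := exists_nat_ge B.
  have [L LP] := int_box_finite N.
  have LB m : A m -> dot (intv R m0) x + w m0 <= dot (intv R m) x + w m -> m \in L.
    move=> Am h; apply: LP; have := EP _ _ Am xT => h2.
    have : \sum_i `|(intv R m) 0 i| <= B by rewrite /B; lra.
    by move=> /le_trans; apply.
  have m0L : m0 \in [seq m <- L | `[< A m >]].
    by rewrite mem_filter LB// andbT; apply/asboolP.
  have [m] := exists_argmax (fun m => dot (intv R m) x + w m) m0L.
  rewrite mem_filter => /andP[/asboolP Am mL] mP.
  exists m; split => // m' Am'.
  have [h|h] := leP (dot (intv R m0) x + w m0) (dot (intv R m') x + w m').
    by apply: mP; rewrite mem_filter LB// andbT; apply/asboolP.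
  by apply: (le_trans (ltW h)); exact: mP.
have [a aP] := choice mP.
exists (fun x => dot (intv R (a x)) x + w (a x)); split.
  by move=> m x Am; apply: (aP x).2.
by move=> x; exists (a x) => //; exact: (aP x).1.
Qed.

(** Near [x0] every active slope has l1-norm at most some [N]. Hence [F] is [N]-Lipschitz there for
    the sup norm, which gives continuity, and is the maximum over the finite list [L'] of slopes. *)
Lemma max_of_regular A w F : A !=set0 -> coercive A w -> max_of A w F -> regular F.
Proof.
move=> A0 cA [Fge Fat].
have act x0 : exists N : nat, \forall x \near x0, forall m, A m ->
    F (x : 'rV_n) = dot (intv R m) x + w m -> \sum_i `|(intv R m) 0 i| <= N%:R.
  have [N NP] := coercive_active A0 cA ((\sum_j `|x0 0 j|) + 1).
  exists N; apply: filterS (near_box x0) => x xb m Am Fx.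
  by apply: NP Am xb _ => m' Am'; rewrite -Fx; exact: Fge.
split.
  move=> x0; have [N NP] := act x0.
  have lip x y m : A m -> F x = dot (intv R m) x + w m ->
      \sum_i `|(intv R m) 0 i| <= N%:R -> forall e, (forall i, `|(x - y) 0 i| <= e) ->
      0 <= e -> F x - F y <= N%:R * e.
    move=> Am Fx mN e xye e0; have := ler_norm_dot (intv R m) xye.
    rewrite ler_norml dotBr => /andP[_ h]; have := Fge m y Am.
    have : (\sum_i `|(intv R m) 0 i|) * e <= N%:R * e by rewrite ler_wpM2r.
    by rewrite Fx; lra.
  apply/(@cvgrPdist_le _ _ _ (nbhs x0) (nbhs_filter x0) F) => e e0.
  pose d := e / N.+1%:R.
  have d0 : 0 < d by rewrite divr_gt0.
  have Nd : N%:R * d <= e.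
    by rewrite /d mulrCA ler_piMr ?(ltW e0)// ler_pdivrMr// mul1r ler_nat.
  near=> x.
  have xd i : `|(x0 - x) 0 i| <= d.
    rewrite !mxE; move: i; near: x; apply/nbhs_ballP; exists d => //= x [_ xb] i.
    exact: ltW (xb 0 i).
  have xd' i : `|(x - x0) 0 i| <= d by rewrite -opprB mxE normrN.
  have [m Am Fm] := Fat x; have [m' Am' Fm'] := Fat x0.
  have mN : \sum_i `|(intv R m) 0 i| <= N%:R.
    by move: m Am Fm; near: x.
  have mN' : \sum_i `|(intv R m') 0 i| <= N%:R.
    by apply: (nbhs_singleton NP).
  rewrite ler_norml; have := lip _ _ _ Am Fm mN _ xd' (ltW d0).
  have := lip _ _ _ Am' Fm' mN' _ xd (ltW d0) => h1 h2.
  by apply/andP; split; lra.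
move=> x0; have [N NP] := act x0.
have [L LP] := int_box_finite N.
pose L' := [seq m <- L | `[< A m >]].
exists (size L'), (fun i => L'`_i), (fun i => w L'`_i).
apply: filterS NP => x xP; apply: bigmaxeP.
  move=> i; rewrite lee_fin; apply: Fge.
  have : L'`_i \in L' by rewrite mem_nth.
  by rewrite mem_filter => /andP[/asboolP].
have [m Am Fm] := Fat x.
have mL : m \in L' by rewrite mem_filter LP ?(xP _ Am Fm)// andbT; apply/asboolP.
have mi : (index m L' < size L')%N by rewrite index_mem.
by exists (Ordinal mi); rewrite /= nth_index// Fm.
Unshelve. all: by end_near. Qed.

End Box.

(** * Theta functions *)

Section Lattice.
Variables (R : realType) (n : nat) (Lam : set 'rV[R]_n).
Hypothesis Lam_lattice : is_lattice Lam.
Implicit Types (x l : 'rV[R]_n).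

Lemma lattice0 : Lam 0.
Proof. by have [P _ ->] := Lam_lattice; exists 0; rewrite // intv0 mul0mx. Qed.

Lemma latticeB l1 l2 : Lam l1 -> Lam l2 -> Lam (l1 - l2).
Proof.
have [P _ ->] := Lam_lattice => -[m1 _ <-] [m2 _ <-].
by exists (m1 - m2); rewrite // intvB mulmxBl.
Qed.

Lemma latticeN l : Lam l -> Lam (- l).
Proof. by rewrite -sub0r; apply: latticeB; exact: lattice0. Qed.

Lemma latticeD l1 l2 : Lam l1 -> Lam l2 -> Lam (l1 + l2).
Proof. by move=> L1 /latticeN; rewrite -{2}[l2]opprK; exact: latticeB. Qed.

(** Rounding down the coordinates in the lattice basis [P] leaves fractional parts below 1, so the
    remainder is bounded by the entries of [P]. *)
Lemma lattice_reduce : exists2 T : R, 0 <= T &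
  forall x, exists2 l, Lam l & forall i, `|(x - l) 0 i| <= T.
Proof.
have [P Pu ->] := Lam_lattice.
exists (\sum_k \sum_i `|P k i|).
  by apply: sumr_ge0 => k _; apply: sumr_ge0.
move=> x; pose t := x *m invmx P; pose m : 'rV[int]_n := \row_i Num.floor (t 0 i).
exists (intv R m *m P); first by exists m.
move=> i; rewrite -{1}(mulmxKV Pu x) -/t -mulmxBl mxE.
rewrite (le_trans (ler_norm_sum _ _ _))// ler_sum// => k _.
rewrite normrM (bigD1 i)//=.
have s0 : 0 <= \sum_(j | j != i) `|P k j| by apply: sumr_ge0.
rewrite -[leLHS]addr0 lerD// -[leRHS]mul1r ler_wpM2r//.
have -> : (t - intv R m) 0 k = t 0 k - (Num.floor (t 0 k))%:~R by rewrite !mxE.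
have := Num.Theory.floor_le (t 0 k); have := Num.Theory.floorD1_gt (t 0 k).
rewrite intrD => h1 h2.
by rewrite ler_norml; apply/andP; split; lra.
Qed.

Lemma box_compact (T : R) : compact [set x : 'rV[R]_n | forall i, `|x 0 i| <= T].
Proof.
have := @rV_compact _ n (fun=> `[- T, T]%classic) (fun=> @segment_compact R _ _).
congr compact; apply/seteqP; split=> x /= xT i; have := xT i.
  by rewrite in_itv/= ler_norml.
by rewrite in_itv/= ler_norml.
Qed.

Lemma periodic_attains_min (p : 'rV[R]_n -> R) : continuous p ->
  (forall x l, Lam l -> p (x + l) = p x) -> exists x0, forall x, p x0 <= p x.
Proof.
move=> pc pper; have [T T0 TP] := lattice_reduce.
have box0 : [set x : 'rV[R]_n | forall i, `|x 0 i| <= T] !=set0.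
  by exists 0 => i /=; rewrite mxE normr0.
have [x0 _ x0P] := EVT_min_rV box0 (@box_compact T) (continuous_subspaceT pc).
exists x0 => x; have [l Ll xl] := TP x.
by rewrite -(subrK l x) pper// x0P// inE.
Qed.

End Lattice.

Section Theta.
Variables (R : realType) (n : nat) (Lam : set 'rV[R]_n).
Hypothesis Lam_lattice : is_lattice Lam.
Variables (Q : 'rV[R]_n -> 'rV[int]_n -> int) (S : 'M[R]_n).
Hypothesis S_ext : real_extension Lam Q S.
Hypothesis S_sym : forall x y, QR S x y = QR S y x.
Hypothesis S_psd : forall x, 0 <= QR S x x.
Implicit Types (x y l : 'rV[R]_n) (m d : 'rV[int]_n).

Local Notation qLam := (qZ Q @` Lam).
Definition integral_image : set 'rV[int]_n :=
  [set m | range (qR S) (intv R m)].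
Local Notation M := integral_image.

Lemma intv_qZ l : Lam l -> intv R (qZ Q l) = qR S l.
Proof.
move=> Ll; apply/rowP => j; rewrite [LHS]mxE [in LHS]mxE -(S_ext (delta_mx 0 j) Ll).
rewrite /QR (_ : intv R (delta_mx 0 j) = delta_mx 0 j) ?dot_delta//.
by apply/rowP => k; rewrite !mxE; case: (_ && _).
Qed.

Lemma qZD l1 l2 : Lam l1 -> Lam l2 -> qZ Q (l1 + l2) = qZ Q l1 + qZ Q l2.
Proof.
move=> L1 L2; apply: (@intv_inj R); rewrite intvD !intv_qZ ?/qR ?mulmxDl//.
exact: latticeD.
Qed.

Lemma qZN l : Lam l -> qZ Q (- l) = - qZ Q l.
Proof.
move=> L1; apply: (@intv_inj R); rewrite intvN !intv_qZ ?/qR ?mulNmx//.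
exact: latticeN.
Qed.

Lemma qLam0 : qLam 0.
Proof.
exists 0; first exact: lattice0.
by apply: (@intv_inj R); rewrite intv_qZ ?intv0 ?/qR ?mul0mx//; exact: lattice0.
Qed.

Lemma qLamN d : qLam d -> qLam (- d).
Proof. by move=> [l Ll <-]; exists (- l); [exact: latticeN|rewrite qZN]. Qed.

Lemma qLamD d1 d2 : qLam d1 -> qLam d2 -> qLam (d1 + d2).
Proof.
by move=> [l1 L1 <-] [l2 L2 <-]; exists (l1 + l2); [exact: latticeD|rewrite qZD].
Qed.

Lemma qLamB d1 d2 : qLam d1 -> qLam d2 -> qLam (d1 - d2).
Proof. by move=> d1P /qLamN; exact: qLamD. Qed.

Lemma qLam_integral_image d : qLam d -> M d.
Proof. by move=> [l Ll <-]; exists l; rewrite // intv_qZ. Qed.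

Lemma integral_imageD m1 m2 : M m1 -> M m2 -> M (m1 + m2).
Proof.
move=> [y1 _ e1] [y2 _ e2]; exists (y1 + y2) => //.
by rewrite intvD -e1 -e2 /qR mulmxDl.
Qed.

(* A preimage of [m] under [qR S] only for [m] in the image. *)
Definition preim_qR m : 'rV[R]_n := intv R m *m pinvmx S.

Lemma preim_qRK m : M m -> qR S (preim_qR m) = intv R m.
Proof. by move=> [y _ e]; rewrite /preim_qR /qR mulmxKpV// -e /qR submxMl. Qed.

(** The excess of [f] over the quadratic function is periodic, so it is enough to bound it on the
    box of lattice remainders [p], where [QR S p p] is dropped as nonnegative. *)
Lemma theta_bounded alpha f : theta_function Lam S alpha f ->
  exists B, forall x, f x <= 2^-1 * QR S x x + dot alpha x + B.
Proof.
move=> [[fc _] fper]; have [T T0 TP] := lattice_reduce Lam_lattice.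
have box0 : [set x : 'rV[R]_n | forall i, `|x 0 i| <= T] !=set0.
  by exists 0 => i /=; rewrite mxE normr0.
have [z _ zP] := EVT_max_rV box0 (@box_compact _ _ T) (continuous_subspaceT fc).
exists (f z + (\sum_i `|alpha 0 i|) * T) => x.
have [l Ll xl] := TP x; set p := x - l in xl.
have xE : x = p + l by rewrite /p subrK.
clearbody p; rewrite {x}xE.
have fp : f p <= f z by apply: zP; rewrite inE.
have := ler_norm_dot alpha xl; rewrite ler_norml => /andP[h _].
rewrite fper// !QRE dotDr (S_sym p l).
by have := S_psd p; lra.
Qed.

(* Along [ker S] the growth of [f] is that of [alpha], which pins down the
   slope of every affine support. *)
Lemma theta_support_range alpha f x0 a : theta_function Lam S alpha f ->
  (forall x, f x0 + dot (intv R a) (x - x0) <= f x) ->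
  exists y, alpha - intv R a = qR S y.
Proof.
move=> ft fa; have [B BP] := theta_bounded ft.
apply: sub_qR_ortho => // v v0; rewrite dotBl; apply/eqP; rewrite subr_eq0.
apply/eqP/esym/eqP; rewrite -subr_eq0; apply/negPn/negP => d0.
set d := _ - _ in d0.
have Qv z : QR S v z = 0 by rewrite /QR v0 dot0l.
(* [K] is the slack at [x0] between [f] and its quadratic bound. Moving by [(K + 1) / d] along [v]
   leaves the quadratic part unchanged and lifts the support by [K + 1] relative to the bound, a
   contradiction. *)
pose K := 2^-1 * QR S x0 x0 + dot alpha x0 + B - f x0.
have := BP (x0 + ((K + 1) / d) *: v); have := fa (x0 + ((K + 1) / d) *: v).
rewrite addrAC subrr add0r !QRE !QRZl !QRZr (S_sym x0 v) !Qv dotDr !dotZr.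
have : (K + 1) / d * d = K + 1 by rewrite divfK.
by rewrite /K /d; lra.
Qed.

Variable r : 'rV[R]_n.

(* For [m = b + q(lam)], the affine function [term m] below is the summand of
   [Theta_b] indexed by [lam]; it depends on [b] and [lam] only through [m]. *)
Definition energy m : R :=
  - (2^-1 * QR S (preim_qR m - r) (preim_qR m - r)).

Definition term m x : R := dot (intv R m) x + energy m.

(** Any preimage [y] of [m] may replace the chosen one, since two preimages differ by an element of
    the kernel of [S], which [QR S] does not see. *)
Lemma termE m x y : qR S y = intv R m ->
  term m x = QR S y x - 2^-1 * QR S (y - r) (y - r).
Proof.
move=> ym; have pm : qR S (preim_qR m) = qR S y by rewrite preim_qRK//; exists y.
rewrite /term /energy -ym -/(QR S y x); congr (_ - _ * _).
by rewrite !QRE !(S_sym r) !(QR_ker _ pm) !(S_sym y (preim_qR m)) (QR_ker _ pm).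
Qed.

(** Quasi-periodicity holds for the family of terms as a whole: translating by [l] only reindexes
    slopes by [q(l)], up to the theta cocycle. *)
Lemma term_shift m x l : M m -> Lam l ->
  term (m + qZ Q l) (x + l) =
  term m x + QR S l x + 2^-1 * QR S l l + QR S r l.
Proof.
move=> [y _ ym] Ll.
rewrite (termE _ (y := y + l)); last by rewrite intvD intv_qZ// -ym /qR mulmxDl.
rewrite (termE _ ym) !QRE (S_sym r y) (S_sym l y) (S_sym r l); lra.
Qed.

Lemma energy_coercive : coercive M energy.
Proof.
have [k k0 kP] := psd_coercive S_sym S_psd.
(* Of [t], the part [|T|] absorbs the pairing with [x] and the 1 leaves the l1-norm demanded by
   [coercive]. Coordinatewise the quadratic decay wins because [(k * |v| - t) ^+ 2] is
   nonnegative. *)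
move=> T; pose t := `|T| + 1; pose rS := qR S r.
exists (\sum_i (t ^+ 2 / (2 * k) + t * `|rS 0 i|)) => m x Mm xT.
have xT' i : `|x 0 i| <= `|T| by exact: le_trans (xT i) (ler_norm T).
have := ler_norm_dot (intv R m) xT'; rewrite ler_norml => /andP[_ h1].
have h2 := kP (preim_qR m - r).
have qE : qR S (preim_qR m - r) = intv R m - rS.
  by rewrite -(preim_qRK Mm) /qR mulmxBl.
rewrite qE in h2.
have h3 : \sum_i (t * `|intv R m 0 i| - 2^-1 * k * (intv R m - rS) 0 i ^+ 2) <=
    \sum_i (t ^+ 2 / (2 * k) + t * `|rS 0 i|).
  apply: ler_sum => i _; set v := (intv R m - rS) 0 i.
  have mv : `|intv R m 0 i| <= `|v| + `|rS 0 i|.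
    have -> : intv R m 0 i = v + rS 0 i.
      by rewrite /v [in RHS]mxE [in X in _ + X + _]mxE subrK.
    exact: ler_normD.
  have t0 : 0 <= t by rewrite addr_ge0.
  have h4 : t * `|intv R m 0 i| <= t * (`|v| + `|rS 0 i|) by rewrite ler_wpM2l.
  suff : t * `|v| - 2^-1 * k * v ^+ 2 <= t ^+ 2 / (2 * k) by lra.
  rewrite ler_pdivlMr ?mulr_gt0// -(real_normK (num_real v)).
  have := sqr_ge0 (k * `|v| - t); rewrite !expr2; nra.
move: h3; rewrite big_split/= sumrN -!mulr_sumr /t /energy mulrDl mul1r.
lra.
Qed.

Local Notation theta := (theta_function Lam S (qR S r)).

(** Stability of [A] and invariance of [s] under [q(Lam)] let [term_shift] move an active term at
    [x] to one at [x + l], giving one inequality of the theta law; the same inequality for [- l]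
    gives the other. The bound [C] preserves coercivity. *)
Lemma theta_max_exists (A : set 'rV[int]_n) (s : 'rV[int]_n -> R) (C : R) :
  A `<=` M -> A !=set0 ->
  (forall m d, A m -> qLam d -> A (m + d)) ->
  (forall m d, A m -> qLam d -> s (m + d) = s m) ->
  (forall m, A m -> s m <= C) ->
  exists2 F, theta F & max_of A (fun m => energy m + s m) F.
Proof.
move=> AM A0 Ast sinv sC.
have Aco : coercive A (fun m => energy m + s m).
  move=> T; have [E EP] := energy_coercive T; exists (E + C) => m x Am xT.
  have := EP m x (AM _ Am) xT; have := sC _ Am; lra.
have [F FP] := max_of_exists A0 Aco; exists F => //.
split; first exact: max_of_regular FP.
have [Fge Fat] := FP.
have Fup l x : Lam l -> F x + QR S l x + 2^-1 * QR S l l + QR S r l <= F (x + l).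
  move=> Ll; have [m Am ->] := Fat x.
  have qd : qLam (qZ Q l) by exists l.
  have := Fge _ (x + l) (Ast _ _ Am qd); rewrite sinv//.
  by have := term_shift x (AM _ Am) Ll; rewrite /term; lra.
move=> l x Ll; apply/eqP; rewrite eq_le -/(QR S r l) Fup// andbT.
have := Fup _ (x + l) (latticeN Lam_lattice Ll).
by rewrite addrK !QRE; lra.
Qed.

Lemma theta_sub_periodic alpha f g : theta_function Lam S alpha f ->
  theta_function Lam S alpha g -> forall x l, Lam l ->
  f (x + l) - g (x + l) = f x - g x.
Proof. by move=> [_ fp] [_ gp] x l Ll; rewrite fp// gp//; ring. Qed.

Lemma theta_sub_min alpha f g : theta_function Lam S alpha f ->
  theta_function Lam S alpha g -> exists x0, forall x, f x0 - g x0 <= f x - g x.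
Proof.
move=> ft gt; apply: (periodic_attains_min Lam_lattice (p := fun x => f x - g x)).
  by move=> x; exact: (cvgB (ft.1.1 x) (gt.1.1 x)).
exact: theta_sub_periodic ft gt.
Qed.

(** Evaluating the support of slope [a] at [x - l] and applying quasi-periodicity to both sides
    turns it into a support of slope [a + q(l)] with the same additive constant relative to
    [term]. *)
Lemma theta_support f x0 : theta f -> exists2 a, M a & forall d x, qLam d ->
  term (a + d) x + (f x0 - term a x0) <= f x.
Proof.
move=> ft; have [a aP] := regular_support x0 ft.1.
have [y yP] := theta_support_range ft aP.
have Ma : M a.
  by exists (r - y); rewrite // /qR mulmxBl -/(qR S r) -/(qR S y) -yP subKr.
exists a => // d x [l Ll <-]; have := aP (x - l).
have := term_shift (x - l) Ma Ll; rewrite subrK => ->.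
have /(_ l (x - l) Ll) := ft.2; rewrite subrK => ->.
by rewrite /term dotBr -/(QR S r l); lra.
Qed.

End Theta.

(** * The torsion part of the cokernel *)

Section Cokernel.
Variables (R : realType) (n : nat) (Lam : set 'rV[R]_n).
Hypothesis Lam_lattice : is_lattice Lam.
Variables (Q : 'rV[R]_n -> 'rV[int]_n -> int) (S : 'M[R]_n).
Hypothesis S_ext : real_extension Lam Q S.
Implicit Types (m d : 'rV[int]_n).

Local Notation qLam := (qZ Q @` Lam).
Local Notation M := (integral_image S).

(** Reducing a preimage of [m] modulo [Lam] into a bounded box changes [m] by an element of [q(Lam)]
    and leaves an integral vector of bounded size. *)
Lemma integral_image_finite_mod : exists L : seq 'rV[int]_n,
  forall m, M m -> exists2 d, d \in L & qLam (m - d).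
Proof.
have [T T0 TP] := lattice_reduce Lam_lattice.
have [N NB] := exists_nat_ge (\sum_i \sum_k T * `|S k i|).
have [L LP] := int_box_finite R n N; exists L => m [y _ ym].
have [l Ll yl] := TP y.
exists (m - qZ Q l); last by rewrite subKr; exists l.
apply/LP/(le_trans _ NB)/ler_sum => i _.
rewrite intvB (intv_qZ S_ext)// -ym /qR -mulmxBl mxE.
rewrite (le_trans (ler_norm_sum _ _ _))// ler_sum// => k _.
by rewrite normrM ler_wpM2r.
Qed.

(* Finiteness of the quotient forces two multiples of [m] into the same class. *)
Lemma torsion_integral_image m :
  (exists2 k : nat, (0 < k)%N & qLam (m *+ k)) <-> M m.
Proof.
split=> [[k k0 [l Ll lm]]|Mm].
  exists (k%:R^-1 *: l) => //.
  rewrite /qR -scalemxAl -/(qR S l) -(intv_qZ S_ext Ll) lm.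
  apply/rowP => j; rewrite !mxE; apply: (canLR (mulKf _)).
    by rewrite pnatr_eq0 -lt0n.
  have -> : (m *+ k) 0 j = m 0 j *+ k.
    by elim: k {k0 lm} => [|k IH]; rewrite ?mulr0n ?mxE// !mulrS mxE IH.
  by rewrite raddfMn/= mulr_natl.
have [L LP] := integral_image_finite_mod.
have MmMn k : M (m *+ k).
  elim: k => [|k IH].
    rewrite mulr0n; apply: (qLam_integral_image S_ext); exact: qLam0 S_ext.
  by rewrite mulrS; exact: integral_imageD.
have [f fP] := choice (fun k => let: ex_intro2 d dL dq := LP _ (MmMn k) in
  ex_intro (fun d => d \in L /\ qLam (m *+ k - d)) d (conj dL dq)).
pose s := [seq f k | k <- iota 0 (size L).+1].
have : ~~ uniq s.
  apply/negP => /(@uniq_leq_size _ _ L).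
  rewrite size_map size_iota ltnn => h.
  by apply/notF/h => d /mapP[k _ ->]; exact: (fP k).1.
move=> /(uniqPn 0)[i [j []]]; rewrite size_map size_iota => ij jL.
rewrite !(nth_map 0%N) ?size_iota ?(ltn_trans ij)// !nth_iota ?(ltn_trans ij)//.
rewrite !add0n => fij; exists (j - i)%N; first by rewrite subn_gt0.
have -> : m *+ (j - i) = (m *+ j - f j) - (m *+ i - f i).
  by rewrite fij opprB addrA subrK mulrnBr// ltnW.
by apply: (qLamB Lam_lattice S_ext); exact: (fP _).2.
Qed.

Lemma Cok_classP m d : Cok_class Lam Q m = Cok_class Lam Q d <-> qLam (m - d).
Proof.
split=> [e|md].
  have : Cok_class Lam Q m m.
    rewrite /Cok_class/= subrr; exact: qLam0 S_ext.
  by rewrite e.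
apply/seteqP; split=> m' h.
  suff : qLam (m' - m + (m - d)) by rewrite addrA subrK.
  exact: (qLamD Lam_lattice S_ext).
suff : qLam (m' - d - (m - d)) by rewrite opprB addrA subrK.
exact: (qLamB Lam_lattice S_ext).
Qed.

Lemma Cok_torsion_finite : finite_set (Cok_torsion Lam Q).
Proof.
have [L LP] := integral_image_finite_mod.
apply: (@sub_finite_set _ _ (Cok_class Lam Q @` [set` L])); last first.
  exact/finite_image/finite_seq.
move=> _ [m /torsion_integral_image Mm <-]; have [d dL md] := LP m Mm.
by exists d => //; apply/esym/Cok_classP.
Qed.

Lemma representatives_exist : exists2 l : nat, (Cok_torsion Lam Q #= `I_l)%card &
  exists b : 'I_l -> 'rV[int]_n, is_representatives Lam Q S b.
Proof.
have [l lP] := Cok_torsion_finite; exists l => //.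
move: lP; rewrite card_eq_sym => /card_set_bijP[f [ffun finj fsurj]].
have bP (i : 'I_l) : exists m, M m /\ Cok_class Lam Q m = f i.
  have [m /torsion_integral_image Mm <-] := ffun i (ltn_ord i).
  by exists m.
have [b {}bP] := choice bP.
exists b; split; first by move=> i; exact: (bP i).1.
move=> m Mm.
have [k /= kl fk] : (f @` `I_l) (Cok_class Lam Q m).
  apply: fsurj; exists m => //; exact/torsion_integral_image.
exists (Ordinal kl); split.
  by apply/Cok_classP; rewrite (bP _).2/= fk.
move=> i /Cok_classP mi; apply/val_inj/finj; rewrite ?inE//=.
by rewrite fk mi (bP i).2.
Qed.

End Cokernel.

(** * Systems of linear inequalities *)

Section LinearSystems.
Variable R : realType.

(* Solution sets of finite systems of affine inequalities, in which trivial
   inequalities [dot 0 s <= c] are allowed. *)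
Definition linear_system d (A : set 'rV[R]_d) : Prop :=
  exists L : seq ('rV[R]_d * R), forall s, A s <-> all (fun p => dot p.1 s <= p.2) L.

Lemma linear_system_forall d k (A : 'I_k -> set 'rV[R]_d) :
  (forall i, linear_system (A i)) -> linear_system [set s | forall i, A i s].
Proof.
move=> /choice[L LP]; exists (flatten [seq L i | i <- enum 'I_k]) => s.
split=> [As|/allP AL i].
  by apply/allP => p /flatten_mapP[i _]; move: p; apply/allP/LP.
by apply/LP/allP => p pL; apply/AL/flatten_mapP; exists i; rewrite ?mem_enum.
Qed.

Lemma linear_systemI d (A B : set 'rV[R]_d) :
  linear_system A -> linear_system B -> linear_system (A `&` B).
Proof.
move=> [L LP] [K KP]; exists (L ++ K) => s; rewrite all_cat; split.
  by move=> [/LP -> /KP ->].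
by move=> /andP[/LP ? /KP ?].
Qed.

(** Trivial inequalities are not half-spaces and are dropped; a point of [A] certifies that they
    hold everywhere. *)
Lemma linear_system_polyhedron d (A : set 'rV[R]_d) :
  A !=set0 -> linear_system A -> polyhedron A.
Proof.
move=> [s0 As0] [L LP]; pose K := [seq p <- L | p.1 != 0].
pose p0 : 'rV[R]_d * R := (0, 0).
exists (size K), (fun i => [set s | dot (nth p0 K i).1 s <= (nth p0 K i).2]).
split=> [i|].
  exists (nth p0 K i).1; last by exists (nth p0 K i).2.
  have : nth p0 K i \in K by rewrite mem_nth.
  by rewrite mem_filter => /andP[].
apply/seteqP; split=> s /=.
  move=> /LP/allP As i _ /=; apply: As.
  have : nth p0 K i \in K by rewrite mem_nth.
  by rewrite mem_filter => /andP[].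
move=> sK; apply/LP/allP => p pL; have [p1|p1] := eqVneq p.1 0.
  have /LP/allP/(_ _ pL) := As0.
  by rewrite p1 !dot0l.
have pK : p \in K by rewrite mem_filter p1.
have pi : (index p K < size K)%N by rewrite index_mem.
by have := sK (Ordinal pi) I; rewrite /= nth_index.
Qed.

Lemma separate_seqs (L U : seq R) :
  (forall x y, x \in L -> y \in U -> x <= y) ->
  exists t, (forall x, x \in L -> x <= t) /\ (forall y, y \in U -> t <= y).
Proof.
elim: L => [_|a L IH LU].
  elim: U => [|b U [t [_ tU]]]; first by exists 0.
  exists (Num.min b t); split=> // y; rewrite inE => /orP[/eqP ->|/tU].
    by rewrite ge_min lexx.
  by move=> ty; rewrite ge_min ty orbT.
have [|t [tL tU]] := IH.
  by move=> x y xL; apply: LU; rewrite inE xL orbT.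
exists (Num.max a t); split=> y.
  by rewrite inE => /orP[/eqP ->|/tL yt]; rewrite le_max ?lexx ?yt ?orbT.
by move=> yU; rewrite ge_max tU// LU// mem_head.
Qed.

(** The pairwise condition says, with denominators cleared, that each lower bound [v q / e q] for
    [t] is at most each upper bound [v p / e p]. *)
Lemma solvable_in_one_variable (T : eqType) (e v : T -> R) (L : seq T) :
  (exists t, forall p, p \in L -> e p * t <= v p) <->
  (forall p, p \in L -> e p = 0 -> 0 <= v p) /\
  (forall p q, p \in L -> q \in L -> 0 < e p -> e q < 0 ->
    0 <= - e q * v p + e p * v q).
Proof.
split=> [[t tP]|[L0 Lpm]].
  split=> [p pL e0|p q pL qL ep eq]; first by have := tP p pL; rewrite e0 mul0r.
  have : - e q * (e p * t) <= - e q * v p by rewrite ler_wpM2l ?tP// oppr_ge0 ltW.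
  have : e p * (e q * t) <= e p * v q by rewrite ler_wpM2l ?tP// ltW.
  by lra.
pose Lo := [seq v q / e q | q <- L & e q < 0].
pose Up := [seq v p / e p | p <- L & 0 < e p].
have [|t [tLo tUp]] := @separate_seqs Lo Up.
  move=> x y /mapP[q]; rewrite mem_filter => /andP[eq qL] ->.
  move=> /mapP[p]; rewrite mem_filter => /andP[ep pL] ->.
  rewrite ler_pdivlMr// mulrAC ler_ndivrMr//.
  by have := Lpm p q pL qL ep eq; lra.
exists t => p pL; have [ep|ep|ep] := ltgtP (e p) 0.
- have := tLo (v p / e p); rewrite ler_ndivrMr// => h; rewrite mulrC; apply: h.
  by apply/mapP; exists p; rewrite ?mem_filter ?ep.
- have := tUp (v p / e p); rewrite ler_pdivlMr// => h; rewrite mulrC; apply: h.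
  by apply/mapP; exists p; rewrite ?mem_filter ?ep.
- by rewrite ep mul0r; exact: L0.
Qed.

Definition tailv k (e : 'rV[R]_k.+1) : 'rV[R]_k := \row_j e 0 (lift ord0 j).

Lemma dot_recl k (e x : 'rV[R]_k.+1) :
  dot e x = e 0 0 * x 0 0 + dot (tailv e) (tailv x).
Proof.
by rewrite /dot big_ord_recl; congr (_ + _); apply: eq_bigr => j _; rewrite !mxE.
Qed.

Lemma exists_cons k (t : R) (x : 'rV[R]_k) :
  exists y : 'rV[R]_k.+1, y 0 0 = t /\ tailv y = x.
Proof.
exists (\row_j oapp (x 0) t (unlift ord0 j)); split.
  by rewrite mxE unlift_none.
by apply/rowP => j; rewrite !mxE liftK.
Qed.

(* Fourier-Motzkin elimination of the variable [x]. *)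
Lemma linear_system_exists d k (L : seq ('rV[R]_d * 'rV[R]_k * R)) :
  linear_system [set s | exists x : 'rV[R]_k,
    all (fun p => dot p.1.1 s + dot p.1.2 x <= p.2) L].
Proof.
elim: k L => [|k IH] L.
  exists [seq (p.1.1, p.2) | p <- L] => s; rewrite all_map.
  have E x p : (dot p.1.1 s + dot p.1.2 (x : 'rV[R]_0) <= p.2) = (dot p.1.1 s <= p.2).
    by rewrite [X in _ + X](_ : _ = 0) ?addr0// /dot big_ord0.
  split=> [[x]|sL]; last exists 0; rewrite (eq_all (E _)); exact: id.
pose T : Type := ('rV[R]_d * 'rV[R]_k.+1 * R)%type.
pose e0 (p : T) : R := p.1.2 0 0.
pose drop (p : T) := (p.1.1, tailv p.1.2, p.2).
(* For [e0 p > 0 > e0 q] this is a positive combination of both inequalities in which the first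
   variable cancels. *)
pose comb (p q : T) := (- e0 q *: p.1.1 + e0 p *: q.1.1,
   - e0 q *: tailv p.1.2 + e0 p *: tailv q.1.2, - e0 q * p.2 + e0 p * q.2).
have [K KP] := IH ([seq drop p | p <- L & e0 p == 0] ++
  [seq comb p q | p <- [seq p <- L | 0 < e0 p], q <- [seq q <- L | e0 q < 0]]).
exists K => s; rewrite -KP /=.
pose v x' (p : T) := p.2 - dot p.1.1 s - dot (tailv p.1.2) x'.
have one x' := solvable_in_one_variable e0 (v x') L.
split=> [[x /allP xL]|[x' /=]].
  exists (tailv x).
  have [] := (one (tailv x)).1.
    exists (x 0 0) => p pL; have := xL p pL; rewrite dot_recl /v /e0; lra.
  move=> h0 hpm; rewrite all_cat; apply/andP; split.
    apply/allP => _ /mapP[p + ->]; rewrite mem_filter => /andP[/eqP ep pL] /=.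
    by have := h0 p pL ep; rewrite /v; lra.
  apply/allP => _ /allpairsP[[p q] /= [+ + ->]].
  rewrite !mem_filter => /andP[ep pL] /andP[eq qL] /=.
  have := hpm p q pL qL ep eq; rewrite /v !dotDl !dotZl; lra.
rewrite all_cat => /andP[/allP h0 /allP hpm].
have [] := (one x').2.
  split=> [p pL ep|p q pL qL ep eq].
    have := h0 (drop p); rewrite /v /drop/= => h.
    suff : dot p.1.1 s + dot (tailv p.1.2) x' <= p.2 by lra.
    by apply: h; apply/mapP; exists p => //; rewrite mem_filter ep eqxx.
  have := hpm (comb p q); rewrite /v /comb/= !dotDl !dotZl => h.
  suff : - e0 q * dot p.1.1 s + e0 p * dot q.1.1 s +
    (- e0 q * dot (tailv p.1.2) x' + e0 p * dot (tailv q.1.2) x') <=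
    - e0 q * p.2 + e0 p * q.2 by lra.
  by apply: h; apply/allpairsP; exists (p, q); rewrite /= !mem_filter ep eq.
move=> t tP; have [x [x0 xt]] := exists_cons t x'.
exists x; apply/allP => p pL; have := tP p pL.
by rewrite dot_recl x0 xt /v /e0; lra.
Qed.

Lemma dot_continuous d (a : 'rV[R]_d) : continuous (dot a).
Proof.
apply: continuous_big => [|i _ x]; first exact: add_continuous.
by apply: cvgMr; [exact: (nbhs_filter x)|exact: coord_continuous].
Qed.

Lemma linear_system_closed d (A : set 'rV[R]_d) : linear_system A -> closed A.
Proof.
move=> [L LP]; have -> : A = [set s | all (fun p => dot p.1 s <= p.2) L].
  by apply/seteqP; split=> s /LP.
elim: L {LP} => [|p L IH] /=.
  by rewrite (_ : [set _ | _] = setT); [exact: closedT|apply/seteqP].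
rewrite (_ : [set _ | _] = [set s | dot p.1 s <= p.2] `&`
  [set s | all (fun p => dot p.1 s <= p.2) L]); last first.
  by apply/seteqP; split=> s /= => [/andP[]|[-> ->]].
apply: closedI IH; apply: (preimage_closed (f := dot p.1) (D := [set y | y <= p.2])).
  by move=> x _; exact: dot_continuous.
exact: closed_le.
Qed.

End LinearSystems.

(** * Coordinates of theta functions *)

Section ThetaBasis.
Variables (R : realType) (n : nat) (Lam : set 'rV[R]_n).
Hypothesis Lam_lattice : is_lattice Lam.
Variables (Q : 'rV[R]_n -> 'rV[int]_n -> int) (S : 'M[R]_n).
Hypothesis S_ext : real_extension Lam Q S.
Hypothesis S_sym : forall x y, QR S x y = QR S y x.
Hypothesis S_psd : forall x, 0 <= QR S x x.
Variables (l : nat) (b : 'I_l -> 'rV[int]_n).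
Hypothesis b_reps : is_representatives Lam Q S b.
Implicit Types (m d : 'rV[int]_n) (x : 'rV[R]_n) (i j : 'I_l) (s : 'rV[R]_l).

Local Notation qLam := (qZ Q @` Lam).
Local Notation M := (integral_image S).

Definition rep_class i : set 'rV[int]_n := [set m | qLam (m - b i)].

Lemma class_of_exists : exists cls : 'rV[int]_n -> 'I_l,
  forall m, M m -> forall i, rep_class i m <-> i = cls m.
Proof.
have cP m : exists i, M m -> forall j, rep_class j m <-> j = i.
  have [Mm|nMm] := pselect (M m).
    have [i [mi iP]] := b_reps.2 m Mm; exists i => _ j.
    by split=> [/iP ->|->].
  (* Off [M] the value is arbitrary; the class of 0 shows that there is an index at all. *)
  have [i _] := b_reps.2 0 (qLam_integral_image S_ext (qLam0 Lam_lattice S_ext)).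
  by exists i.
by have [cls clsP] := choice cP; exists cls.
Qed.

Lemma rep_class_integral_image i : rep_class i `<=` M.
Proof.
move=> m /(qLam_integral_image S_ext)/(integral_imageD (b_reps.1 i)).
by rewrite addrC subrK.
Qed.

Lemma rep_classD i m d : rep_class i m -> qLam d -> rep_class i (m + d).
Proof.
by move=> mi qd; rewrite /rep_class/= addrAC; apply: (qLamD Lam_lattice S_ext).
Qed.

Lemma rep_class_self i : rep_class i (b i).
Proof. by rewrite /rep_class/= subrr; exact: (qLam0 Lam_lattice S_ext). Qed.

Variable r : 'rV[R]_n.
Local Notation theta := (theta_function Lam S (qR S r)).
Local Notation term := (term S r).
Local Notation energy := (energy S r).

Lemma theta_basis_exists : exists F : 'I_l -> 'rV[R]_n -> R,
  forall i, theta (F i) /\ max_of (rep_class i) energy (F i).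
Proof.
suff /choice[F FP] : forall i, exists F, theta F /\ max_of (rep_class i) energy F.
  by exists F.
move=> i.
have [F Ft [Fge Fat]] := @theta_max_exists _ _ _ Lam_lattice _ _ S_ext S_sym S_psd
  r (rep_class i) (fun=> 0) 0 (@rep_class_integral_image i)
  (ex_intro _ _ (rep_class_self i)) (@rep_classD i) (fun _ _ _ _ => erefl)
  (fun _ _ => lexx 0).
exists F; split=> //; split=> [m x mi|x]; first by have := Fge m x mi; rewrite addr0.
by have [m mi ->] := Fat x; exists m; rewrite ?addr0.
Qed.

Variable F : 'I_l -> 'rV[R]_n -> R.
Hypothesis F_theta : forall i, theta (F i).
Hypothesis F_max : forall i, max_of (rep_class i) energy (F i).

(* [s 0 i] is the number [phi^b(f)] for [b = b i], [F i] being [Theta_b]. *)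
Definition coordinates (f : 'rV[R]_n -> R) s : Prop :=
  forall i, (forall x, s 0 i + F i x <= f x) /\ exists x, f x = s 0 i + F i x.

Lemma coordinates_exist f : theta f -> exists s, coordinates f s.
Proof.
move=> ft; have [x xP] := choice (fun i => theta_sub_min Lam_lattice ft (F_theta i)).
exists (\row_i (f (x i) - F i (x i))) => i; rewrite mxE; split=> [y|].
  by have := xP i y; lra.
by exists (x i); rewrite subrK.
Qed.

(** This is the decomposition of [f] as the maximum of the [s 0 i + F i]. A support of slope [a] at
    [x0], spread over the class of [a], puts [F i] plus a constant below [f]; comparison at a point
    where [f] meets [s 0 i + F i] bounds that constant by [s 0 i], which forces equality at [x0]. *)
Lemma coordinates_attained f s : theta f -> coordinates f s ->
  forall x, exists i, f x = s 0 i + F i x.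
Proof.
move=> ft fs x0.
have [a Ma aP] := theta_support Lam_lattice S_ext S_sym S_psd x0 ft.
have [i [qi _]] := b_reps.2 a Ma; exists i; apply/eqP; rewrite eq_le (fs i).1 andbT.
have ai : rep_class i a by [].
have [x fx] := (fs i).2.
have [m mi Fm] := (F_max i).2 x.
have := aP (m - a) x; rewrite [a + _]addrC subrK => h.
have /h : qLam (m - a).
  have -> : m - a = (m - b i) - (a - b i) by rewrite opprB addrA subrK.
  exact: (qLamB Lam_lattice S_ext).
have := (F_max i).1 a x0 ai.
by rewrite fx Fm /term; lra.
Qed.

Lemma coordinates_inj f g s : theta f -> theta g ->
  coordinates f s -> coordinates g s -> f = g.
Proof.
move=> ft gt fs gs; apply/funext => x; apply/eqP; rewrite eq_le.
have [i fi] := coordinates_attained ft fs x.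
have [j gj] := coordinates_attained gt gs x.
by rewrite {1}fi (gs i).1 gj (fs j).1.
Qed.

(** The vectors [s] for which each [F i + s 0 i] is dominant somewhere; this will be the image of
    the finite sections under [phi]. *)
Definition coord_set : set 'rV[R]_l :=
  [set s | forall i, exists x, forall j, F j x + s 0 j <= F i x + s 0 i].

Lemma coordinates_coord_set f s : theta f -> coordinates f s -> coord_set s.
Proof.
move=> ft fs i; have [x fx] := (fs i).2; exists x => j.
by have := (fs j).1 x; rewrite fx; lra.
Qed.

(** The section is the maximum of all terms with slope in [M], each raised by the coordinate of its
    class. Dominance of [F i + s 0 i] at some point makes the [i]-th coordinate exactly [s 0 i]. *)
Lemma coord_set_coordinates s : coord_set s -> exists2 f, theta f & coordinates f s.
Proof.
move=> sP; have [cls clsP] := class_of_exists.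
have clsD m d : M m -> qLam d -> cls (m + d) = cls m.
  move=> Mm qd; apply/esym/clsP.
    exact: integral_imageD Mm (qLam_integral_image S_ext qd).
  by apply: rep_classD => //; exact/clsP.
have sC i : s 0 i <= \sum_i `|s 0 i|.
  by rewrite (bigD1 i)//= ler_wpDr ?ler_norm//; exact: sumr_ge0.
have [f ft [fge fat]] := @theta_max_exists _ _ _ Lam_lattice _ _ S_ext S_sym S_psd
  r M (fun m => s 0 (cls m)) (\sum_i `|s 0 i|) (fun _ h => h)
  (ex_intro _ 0 (qLam_integral_image S_ext (qLam0 Lam_lattice S_ext)))
  (fun m d Mm qd => integral_imageD Mm (qLam_integral_image S_ext qd))
  (fun m d Mm qd => congr1 (s 0) (clsD m d Mm qd))
  (fun m _ => sC (cls m)).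
exists f => // i.
have fF x : s 0 i + F i x <= f x.
  have [m mi ->] := (F_max i).2 x; have Mm := rep_class_integral_image mi.
  by have := fge m x Mm; rewrite -((clsP _ Mm i).1 mi); lra.
split=> //; have [x xP] := sP i; exists x; apply/eqP; rewrite eq_le fF andbT.
have [m Mm ->] := fat x; have := (F_max (cls m)).1 m x ((clsP m Mm _).2 erefl).
by have := xP (cls m); lra.
Qed.

Lemma basis_difference_bounded : exists C, forall i j x, F j x - F i x <= C.
Proof.
have cP (ij : 'I_l * 'I_l) : exists x0, forall x,
    F ij.2 x - F ij.1 x <= F ij.2 x0 - F ij.1 x0.
  have [x0 x0P] := theta_sub_min Lam_lattice (F_theta ij.1) (F_theta ij.2).
  by exists x0 => x; have := x0P x; lra.
have [y yP] := choice cP.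
exists (\sum_ij `|F ij.2 (y ij) - F ij.1 (y ij)|) => i j x.
rewrite (le_trans (yP (i, j) x))// (bigD1 (i, j))//= ler_wpDr ?ler_norm//.
exact: sumr_ge0.
Qed.

(* Translating by a lattice vector moves any point to one where [b i] itself is
   the active slope of [F i]; from a fixed box, finitely many translations suffice. *)
Lemma bounded_base_point i : exists T : R, forall x, exists x' : 'rV[R]_n,
  [/\ forall k, `|x' 0 k| <= T, F i x' = term (b i) x' &
      forall j, F j x' - F i x' = F j x - F i x].
Proof.
have [T0 T00 T0P] := lattice_reduce Lam_lattice.
have Aco : coercive (rep_class i) energy.
  move=> T; have [E EP] := energy_coercive S_sym S_psd r T.
  by exists E => m x /rep_class_integral_image; exact: EP.
have [N NP] := coercive_active (ex_intro _ _ (rep_class_self i)) Aco T0.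
have [L LP] := int_box_finite R n N.
have lamP d : exists v, qLam d -> Lam v /\ qZ Q v = d.
  have [[v Lv vd]|nd] := pselect (qLam d); first by exists v.
  by exists 0 => /nd.
have [lam {}lamP] := choice lamP.
(* [T0] bounds the reduced point [y]; the sum bounds the further translation, which depends only on
   the active slope [m], one of the finite list [L]. *)
exists (T0 + \sum_(m <- L) \sum_k `|lam (m - b i) 0 k|) => x.
have [v Lv xv] := T0P x; set y := x - v in xv.
have yE j : F j y - F i y = F j x - F i x.
  have := theta_sub_periodic (F_theta j) (F_theta i) y Lv.
  by rewrite /y subrK => <-.
have [m mi Fm] := (F_max i).2 y.
have [Lmu qmu] := lamP _ mi; set mu := lam _ in Lmu qmu.
(* The active slope at [y] is [m = b i + q(mu)], so translating back by [mu] makes [b i] active. *)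
exists (y - mu); split.
- move=> k; rewrite mxE [X in _ + X]mxE (le_trans (ler_normB _ _))// lerD//.
  have mL : m \in L.
    apply: LP; apply: (NP m y) => // m' m'i.
    by rewrite -Fm; exact: (F_max i).1.
  rewrite (perm_big _ (perm_to_rem mL)) big_cons ler_wpDr//.
    by apply: sumr_ge0 => ? _; apply: sumr_ge0.
  by rewrite (bigD1 k)//= ler_wpDr//; apply: sumr_ge0.
- have := term_shift S_ext S_sym r (y - mu) (b_reps.1 i) Lmu.
  rewrite subrK qmu [b i + _]addrC subrK => h.
  have := (F_theta i).2 mu (y - mu) Lmu; rewrite subrK.
  rewrite Fm -/(term m y) h -/(QR S r mu); lra.
- move=> j; rewrite -yE.
  by have := theta_sub_periodic (F_theta j) (F_theta i) (y - mu) Lmu; rewrite subrK.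
Qed.

Lemma coord_set_difference C s : (forall i j x, F j x - F i x <= C) -> coord_set s ->
  forall i j, s 0 j - s 0 i <= C.
Proof.
move=> CP sP i j; have [x /(_ j) xP] := sP i.
by have := CP j i x; lra.
Qed.

Lemma linear_system_base_point (C : R) i : exists2 A : set 'rV[R]_l, linear_system A &
  forall s, (forall i j, s 0 j - s 0 i <= C) ->
    (A s <-> exists x, forall j, F j x + s 0 j <= F i x + s 0 i).
Proof.
have [cls clsP] := class_of_exists.
have [T TP] := bounded_base_point i.
have [E EP] := energy_coercive S_sym S_psd r T.
(* A slope of l1-norm above [N] lies more than [C] below [term (b i)] throughout the box, so no [s]
   with differences at most [C] lets it violate dominance. *)
have [N NB] := exists_nat_ge (E + C - energy (b i) + (\sum_k `|intv R (b i) 0 k|) * T).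
have [L LP] := int_box_finite R n N.
pose box : seq ('rV[R]_l * 'rV[R]_n * R) :=
  [seq (0, delta_mx 0 k : 'rV[R]_n, T) | k <- enum 'I_n] ++
  [seq (0, - delta_mx 0 k : 'rV[R]_n, T) | k <- enum 'I_n].
(* Here [F i] is replaced by its summand of slope [b i]. This strengthens the condition at a given
   point, but [bounded_base_point] provides a point where both agree. *)
pose cell : seq ('rV[R]_l * 'rV[R]_n * R) :=
  [seq (delta_mx 0 (cls m) - delta_mx 0 i, intv R m - intv R (b i),
        energy (b i) - energy m) | m <- L & `[< M m >]].
have boxP s x : all (fun p => dot p.1.1 s + dot p.1.2 x <= p.2) box <->
    forall k, `|x 0 k| <= T.
  rewrite all_cat all_map [X in _ && X]all_map; split=> [/andP[/allP h1 /allP h2] k|xT].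
    have := h1 k; rewrite mem_enum => /(_ isT).
    have := h2 k; rewrite mem_enum => /(_ isT).
    rewrite /= !dot0l !add0r dotNl ![dot (delta_mx _ _) _]dotC !dot_delta ler_norml.
    move=> h3 h4.
    by apply/andP; split; lra.
  apply/andP; split; apply/allP => k _ /=; have := xT k;
    rewrite dot0l add0r ?dotNl [dot (delta_mx _ _) _]dotC dot_delta ler_norml;
    move=> /andP[]; lra.
have cellP s x : all (fun p => dot p.1.1 s + dot p.1.2 x <= p.2) cell <->
    forall m, m \in L -> M m -> term m x + s 0 (cls m) <= term (b i) x + s 0 i.
  have E1 m : (dot (delta_mx 0 (cls m) - delta_mx 0 i) s +
      dot (intv R m - intv R (b i)) x <= energy (b i) - energy m) =
      (term m x + s 0 (cls m) <= term (b i) x + s 0 i).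
    rewrite !dotBl ![dot (delta_mx _ _) _]dotC !dot_delta /term.
    by apply/idP/idP; lra.
  rewrite all_map; split=> [/allP h m mL Mm|h].
    by have := h m; rewrite mem_filter mL andbT /= E1; apply; apply/asboolP.
  apply/allP => m; rewrite mem_filter => /andP[/asboolP Mm mL] /=.
  by rewrite E1; exact: h.
eexists; first exact: (@linear_system_exists _ _ _ (box ++ cell)).
move=> s sC; split=> [[x]|[x0 x0P]] /=.
  rewrite all_cat => /andP[/boxP xT /cellP xc]; exists x => j.
  have [m mj Fm] := (F_max j).2 x; have Mm := rep_class_integral_image mj.
  rewrite Fm -/(term m x).
  have := (F_max i).1 _ x (rep_class_self i); rewrite -/(term (b i) x) => hF.
  suff : term m x + s 0 j <= term (b i) x + s 0 i by lra.
  have [mL|mL] := boolP (m \in L).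
    by rewrite [in s 0 j]((clsP _ Mm j).1 mj); exact: xc.
  have : ~~ (\sum_k `|(intv R m) 0 k| <= N%:R) by apply: contra mL; exact: LP.
  rewrite -ltNge => hN.
  have := EP m x Mm xT; have := sC i j.
  have := ler_norm_dot (intv R (b i)) xT; rewrite ler_norml => /andP[h1 _].
  by rewrite -/(term m x) {3}/term; lra.
have [x [xT Fx xE]] := TP x0; exists x.
rewrite all_cat; apply/andP; split; first exact/boxP.
apply/cellP => m _ Mm; rewrite -Fx.
have := (F_max (cls m)).1 m x ((clsP m Mm _).2 erefl); rewrite -/(term m x).
by have := xE (cls m); have := x0P (cls m); lra.
Qed.

(** The elimination is valid only for [s] with bounded coordinate differences; those bounds hold on
    [coord_set] and are linear themselves, so they join the system as [D]. *)
Lemma coord_set_linear_system : linear_system coord_set.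
Proof.
have [C CP] := basis_difference_bounded.
have [A AP'] := choice (fun i =>
  let: ex_intro2 A Al AP := linear_system_base_point C i in
  ex_intro (fun A => linear_system A /\ _) A (conj Al AP)).
have [Alin AP] := (fun i => (AP' i).1, fun i => (AP' i).2).
pose D := [set s : 'rV[R]_l | forall i j, s 0 j - s 0 i <= C].
have Dlin : linear_system D.
  apply: (linear_system_forall (A := fun i => [set s | forall j, s 0 j - s 0 i <= C])).
  move=> i; apply: (linear_system_forall (A := fun j => [set s | s 0 j - s 0 i <= C])).
  move=> j; exists [:: (delta_mx 0 j - delta_mx 0 i, C)] => s /=.
  by rewrite andbT dotBl ![dot (delta_mx _ _) _]dotC !dot_delta.
have -> : coord_set = D `&` [set s | forall i, A i s].
  apply/seteqP; split=> s.
    move=> sP; have sC := coord_set_difference CP sP.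
    by split=> // i; apply/(AP i).
  by move=> [sC sA] i; apply/(AP i).
exact/linear_systemI/linear_system_forall.
Qed.

(** At [y - r], completing the square puts the term of slope [m] below that of slope [b i] by half
    of [QR S (z - y) (z - y)]. For [m] different from [b i], [z - y] maps to a nonzero integral
    vector, so the gap is at least [k / 2], and two perturbations of size [k / 4] cannot close
    it. *)
Lemma coord_set_interior : exists2 e : R, 0 < e &
  forall s, (forall i, `|s 0 i| <= e) -> coord_set s.
Proof.
have [k k0 kP] := psd_coercive S_sym S_psd.
exists (k / 4); first by rewrite divr_gt0.
move=> s se i; have [y _ yb] := b_reps.1 i; exists (y - r) => j.
have [m mj ->] := (F_max j).2 (y - r).
have Mm := rep_class_integral_image mj; have [z _ zm] := Mm.
have Fi := (F_max i).1 _ (y - r) (rep_class_self i).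
rewrite -/(term _ _) (termE S_sym _ _ zm).
rewrite -/(term _ _) (termE S_sym _ _ yb) in Fi.
have := S_psd (z - y); have := kP (z - y).
have gap : QR S z (y - r) - 2^-1 * QR S (z - r) (z - r) =
    QR S y (y - r) - 2^-1 * QR S (y - r) (y - r) - 2^-1 * QR S (z - y) (z - y).
  rewrite !QRE (S_sym y z) (S_sym r z) (S_sym r y); lra.
have [mb|mb] := eqVneq m (b i).
  have -> : j = i.
    have [i' [_ i'P]] := b_reps.2 m Mm.
    by rewrite -(i'P j mj) -(i'P i)// mb; exact: rep_class_self.
  by lra.
have [c mc] : exists c, m 0 c != b i 0 c.
  apply/existsP; apply: contraNT mb => /existsPn h; apply/eqP/rowP => c.
  exact/eqP/negPn/h.
have c1 : 1 <= (qR S (z - y)) 0 c ^+ 2.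
  rewrite /qR mulmxBl -/(qR S z) -/(qR S y) zm yb -intvB mxE.
  rewrite -rmorphXn/= -[1]/(1%:~R) ler_int.
  rewrite -gtz0_ge1 exprn_even_gt0//= !mxE subr_eq0 mc//.
have : 1 <= \sum_c (qR S (z - y)) 0 c ^+ 2.
  rewrite (bigD1 c)//= ler_wpDr//; apply: sumr_ge0 => ? _; exact: sqr_ge0.
rewrite -(ler_pM2l k0) mulr1.
have := se i; have := se j; rewrite !ler_norml => /andP[_ h1] /andP[h2 _]; lra.
Qed.

End ThetaBasis.

(** * Attained extrema, the quotient by the diagonal line, and full dimension *)

Section ExtremeValues.
Variable R : realType.

Lemma ereal_sup_max (A : set \bar R) y : A y -> ubound A y -> ereal_sup A = y.
Proof.
move=> Ay yub; apply/eqP; rewrite eq_le; apply/andP; split.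
  exact: ge_ereal_sup.
exact: ereal_sup_ubound.
Qed.

Lemma ereal_inf_min (A : set \bar R) y : A y -> lbound A y -> ereal_inf A = y.
Proof.
move=> Ay ylb; apply/eqP; rewrite eq_le; apply/andP; split.
  exact: ereal_inf_lbound.
exact: le_ereal_inf_tmp.
Qed.

End ExtremeValues.

Section Projection.
Variables (R : realType) (l : nat).
Implicit Types (s : 'rV[R]_l).

Lemma proj_coordD_const i s t : proj_coord i (s + const_mx t) = proj_coord i s.
Proof. by apply/rowP => j; rewrite !mxE; lra. Qed.

Lemma proj_coord_eq i s s' : proj_coord i s = proj_coord i s' ->
  s' = s + const_mx (s' 0 i - s 0 i).
Proof.
move=> e; apply/rowP => j; rewrite !mxE.
have [k ->|->] := unliftP i j; last by lra.
by have := congr1 (fun u : 'rV_l.-1 => u 0 k) e; rewrite !mxE; lra.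
Qed.

(** The section of [proj_coord i] picking the representative with vanishing coordinate [i]; pulling
    inequalities back along it describes the projected polyhedron. *)
Definition insert0 (i : 'I_l) (u : 'rV[R]_l.-1) : 'rV[R]_l :=
  \row_j oapp (u 0) 0 (unlift i j).

Lemma insert0K i : cancel (insert0 i) (proj_coord i).
Proof.
move=> u; apply/rowP => k.
by rewrite !mxE liftK unlift_none /= subr0.
Qed.

Lemma dot_insert0 i (a : 'rV[R]_l) u : dot a (insert0 i u) = dot (col' i a) u.
Proof.
rewrite /dot (bigD1_ord i)//= mxE unlift_none mulr0 add0r.
by apply: eq_bigr => k _; rewrite !mxE liftK.
Qed.

Lemma proj_coordK i s : insert0 i (proj_coord i s) = s + const_mx (- s 0 i).
Proof.
have /proj_coord_eq -> : proj_coord i s = proj_coord i (insert0 i (proj_coord i s)).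
  by rewrite insert0K.
by congr (_ + const_mx _); rewrite mxE unlift_none /= sub0r.
Qed.

Variable P : set 'rV[R]_l.
Hypothesis P_lin : linear_system P.
Hypothesis P_const : forall s t, P s -> P (s + const_mx t).

Lemma proj_coord_imageP i u : (proj_coord i @` P) u <-> P (insert0 i u).
Proof.
split=> [[s Ps <-]|Pu]; first by rewrite proj_coordK; exact: P_const.
by exists (insert0 i u); rewrite // insert0K.
Qed.

Lemma proj_coord_linear_system i : linear_system (proj_coord i @` P).
Proof.
have [L LP] := P_lin; exists [seq (col' i p.1, p.2) | p <- L] => u.
rewrite all_map proj_coord_imageP LP.
suff -> : all (fun p => dot p.1 (insert0 i u) <= p.2) L =
  all (preim (fun p => (col' i p.1, p.2)) (fun p => dot p.1 u <= p.2)) L by [].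
by apply: eq_all => p /=; rewrite dot_insert0.
Qed.

(** The coordinates of a projected point are differences [s 0 k - s 0 i], so the image lies in a
    box, and it is closed as the solution set of a linear system. *)
Lemma proj_coord_compact i (C : R) :
  (forall s, P s -> forall j k, s 0 k - s 0 j <= C) -> compact (proj_coord i @` P).
Proof.
move=> PC.
have clP := linear_system_closed (proj_coord_linear_system i).
apply: (subclosed_compact clP (@box_compact _ _ C)).
move=> _ [s Ps <-] k /=; rewrite !mxE ler_norml; apply/andP; split.
  by rewrite lerNl opprB PC.
exact: PC.
Qed.

End Projection.

Section Regular.
Variables (R : realType) (n : nat).

Lemma regularD_affine (f : 'rV[R]_n -> R) (m : 'rV[int]_n) (t : R) :
  regular f -> regular (fun x => f x + dot (intv R m) x + t).
Proof.
move=> [fc floc]; split.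
  have tc : continuous (fun _ : 'rV[R]_n => t) by exact: cst_continuous.
  by move=> x; exact: (cvgD (cvgD (fc x) (@dot_continuous _ _ (intv R m) x)) (tc x)).
move=> x0; have [k [a [c fE]]] := floc x0.
exists k, (fun i => a i + m), (fun i => c i + t); apply: filterS fE => x fx.
apply: bigmaxeP.
  move=> i; have := le_bigmax -oo%E (fun i => (dot (intv R (a i)) x + c i)%:E) i.
  by rewrite -fx !lee_fin intvD dotDl; lra.
have [i fi] := bigmaxe_attained fx.
by exists i; rewrite fi intvD dotDl; congr EFin; lra.
Qed.

(** Used with slope [gamma] or [- gamma] to pass between [alpha] and [qR S r], and with slope 0 for
    tropical scaling. *)
Lemma theta_functionD_affine (Lam : set 'rV[R]_n) S alpha (m : 'rV[int]_n) t f :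
  theta_function Lam S alpha f -> theta_function Lam S (alpha + intv R m)
    (fun x => f x + dot (intv R m) x + t).
Proof.
move=> [fr fp]; split; first exact: regularD_affine.
by move=> l x Ll; rewrite fp// dotDr dotDl; lra.
Qed.

End Regular.

Section Polyhedron.
Variables (R : realType) (l : nat) (P : set 'rV[R]_l).

Lemma affine_dim_full (e : R) : 0 < e ->
  (forall s : 'rV[R]_l, (forall i, `|s 0 i| <= e) -> P s) -> affine_dim P l.
Proof.
move=> e0 eP; exists 0, 1%:M; split.
- by apply: eP => i; rewrite mxE normr0 ltW.
- by move=> y _; exact: submx1.
- move=> V VP; apply/row_subP => i; rewrite row1.
  have : (e *: (delta_mx 0 i : 'rV[R]_l) - 0 <= V)%MS.
    apply: VP; apply: eP => j; rewrite !mxE/=; case: (j == i).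
      by rewrite mulr1 gtr0_norm.
    by rewrite mulr0 normr0 ltW.
  by rewrite subr0 => /(scalemx_sub e^-1); rewrite scalerA mulVf ?gt_eqF// scale1r.
- exact: mxrank1.
Qed.

End Polyhedron.

(** * Sections and their projectivization *)

Section Sections.
Variables (R : realType) (n : nat) (Lam : set 'rV[R]_n).
Hypothesis Lam_lattice : is_lattice Lam.
Variables (Q : 'rV[R]_n -> 'rV[int]_n -> int) (S : 'M[R]_n).
Hypothesis S_ext : real_extension Lam Q S.
Hypothesis S_sym : forall x y, QR S x y = QR S y x.
Hypothesis S_psd : forall x, 0 <= QR S x x.
Variables (l : nat) (b : 'I_l -> 'rV[int]_n).
Hypothesis b_reps : is_representatives Lam Q S b.
Variables (alpha r : 'rV[R]_n) (gamma : 'rV[int]_n).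
Hypothesis alphaE : alpha = qR S r + intv R gamma.
Variable F : 'I_l -> 'rV[R]_n -> R.
Hypothesis F_theta : forall i, theta_function Lam S (qR S r) (F i).
Hypothesis F_max : forall i, max_of (rep_class Lam Q b i) (energy S r) (F i).
Implicit Types (f : 'rV[R]_n -> R) (s : 'rV[R]_l) (x : 'rV[R]_n) (i j : 'I_l).

Local Notation theta := (theta_function Lam S alpha).
Local Notation theta_r := (theta_function Lam S (qR S r)).
Local Notation untwist f := (fun x => f x - dot (intv R gamma) x).
Local Notation sec := (sections Lam S alpha).

Lemma untwist_theta f : theta f -> theta_r (untwist f).
Proof.
move=> /(theta_functionD_affine (- gamma) 0); rewrite alphaE intvN addrK.
congr theta_function; apply/funext => x.
by rewrite dotNl addr0.
Qed.

Lemma twist_theta f : theta_r f -> theta (fun x => f x + dot (intv R gamma) x).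
Proof.
move=> /(theta_functionD_affine gamma 0); rewrite -alphaE.
by congr theta_function; apply/funext => x; rewrite addr0.
Qed.

Lemma theta_functionD_cst f t : theta f -> theta (fun x => f x + t).
Proof.
move=> /(theta_functionD_affine 0 t); rewrite intv0 addr0.
by congr theta_function; apply/funext => x; rewrite dot0l addr0.
Qed.

Definition coords f s := coordinates F (untwist f) s.

Lemma coords_exist f : theta f -> exists s, coords f s.
Proof.
by move=> /untwist_theta ft; exact: (coordinates_exist Lam_lattice F_theta ft).
Qed.

Lemma coords_attained f s : theta f -> coords f s -> forall x, exists i,
  f x = s 0 i + (F i x + dot (intv R gamma) x).
Proof.
move=> /untwist_theta ft fs x.
have [i] := coordinates_attained Lam_lattice S_ext S_sym S_psd b_reps F_max ft fs x.
by move=> fi; exists i; lra.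
Qed.

Lemma coords_inj f g s : theta f -> theta g -> coords f s -> coords g s -> f = g.
Proof.
move=> /untwist_theta ft /untwist_theta gt fs gs; apply/funext => x.
have /(congr1 (fun h => h x)) :=
  coordinates_inj Lam_lattice S_ext S_sym S_psd b_reps F_max ft gt fs gs.
by move=> e; lra.
Qed.

Lemma coordsD_cst f s t : coords f s -> coords (fun x => f x + t) (s + const_mx t).
Proof.
move=> fs i; rewrite !mxE; split=> [x|]; first by have := (fs i).1 x; lra.
by have [x fx] := (fs i).2; exists x; lra.
Qed.

Lemma coord_set_const s t : coord_set F s -> coord_set F (s + const_mx t).
Proof.
by move=> sP i; have [x xP] := sP i; exists x => j; rewrite !mxE; have := xP j; lra.
Qed.

Lemma coords_coord_set f s : theta f -> coords f s -> coord_set F s.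
Proof. by move=> /untwist_theta; exact: coordinates_coord_set. Qed.

Lemma coord_set_coords s : coord_set F s -> exists2 f, theta f & coords f s.
Proof.
move=> sP.
have [f /twist_theta ft fs] := coord_set_coordinates Lam_lattice S_ext S_sym S_psd
  b_reps F_max sP.
exists (fun x => f x + dot (intv R gamma) x) => //.
by move: fs; congr coordinates; apply/funext => x; rewrite addrK.
Qed.

Lemma sections_generated :
  generates sec (fun i => EFin \o (fun x => F i x + dot (intv R gamma) x)).
Proof.
split=> [i|h [[f ft <-]|->]].
- by left; exists (fun x => F i x + dot (intv R gamma) x) => //; exact: twist_theta.
- have [s fs] := coords_exist ft.
  exists (fun i => (s 0 i)%:E) => //; apply/funext => x /=; apply: bigmaxeP.
    by move=> i; rewrite -EFinD lee_fin; have := (fs i).1 x; lra.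
  have [i ->] := coords_attained ft fs x; exists i.
  by rewrite -EFinD; congr EFin; lra.
- exists (fun=> -oo%E) => //; apply/funext => x /=.
  by apply/eqP; rewrite eq_le leNye andTb; apply: bigmax_le => // i _; rewrite addeNy.
Qed.

Lemma sections_finiteP h : (sec `\ cst -oo%E) h <-> exists2 f, theta f & h = EFin \o f.
Proof.
split=> [[[[f ft <-]|->] ne]|[f ft ->]]; [by exists f|by case: ne|].
split; first by left; exists f.
by move=> /(congr1 (fun g => g 0)).
Qed.

Variable c : 'I_l -> 'rV[R]_n.
Hypothesis c_preim : forall i, qR S (c i) = intv R (b i).
Local Notation ph := (phi Lam Q S r gamma b c).

Lemma theta_termE i x lam : Lam lam ->
  theta_term Q S r (b i) (c i) x lam = term S r (b i + qZ Q lam) x.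
Proof.
move=> Ll; have e : qR S (lam + c i) = intv R (b i + qZ Q lam).
  by rewrite intvD (intv_qZ S_ext Ll) -c_preim /qR mulmxDl addrC.
by rewrite (termE S_sym _ _ e) /QR e.
Qed.

Lemma theta_bE i x : theta_b Lam Q S r (b i) (c i) x = (F i x)%:E.
Proof.
apply: ereal_sup_max.
  have [m [lam Ll lm] Fm] := (F_max i).2 x.
  by exists lam => //; rewrite theta_termE// Fm lm addrC subrK.
move=> _ [mu Lmu <-]; rewrite lee_fin !theta_termE//.
by apply: (F_max i).1; exists mu; rewrite // addrC addKr.
Qed.

Lemma theta_b_attained i x : exists2 lam, Lam lam &
  theta_b Lam Q S r (b i) (c i) x = (theta_term Q S r (b i) (c i) x lam)%:E.
Proof.
have [m [lam Ll lm] Fm] := (F_max i).2 x.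
by exists lam; rewrite // theta_bE theta_termE// Fm lm [b i + _]addrC subrK.
Qed.

Lemma phi_termE f i x : phi_term Lam Q S r gamma (b i) (c i) (EFin \o f) x =
  (f x - dot (intv R gamma) x - F i x)%:E.
Proof. by rewrite /phi_term theta_bE. Qed.

Lemma phi_attained f s i : coords f s -> exists2 x,
  ph (EFin \o f) 0 i = phi_term Lam Q S r gamma (b i) (c i) (EFin \o f) x &
  ph (EFin \o f) 0 i = (s 0 i)%:E.
Proof.
move=> fs; have [x fx] := (fs i).2; exists x.
  rewrite mxE; apply: ereal_inf_min; first by exists x.
  move=> _ [y _ <-]; rewrite !phi_termE lee_fin.
  by have := (fs i).1 y; lra.
rewrite mxE; apply: ereal_inf_min.
  by exists x; rewrite // phi_termE; congr EFin; lra.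
move=> _ [y _ <-]; rewrite phi_termE lee_fin.
by have := (fs i).1 y; lra.
Qed.

Lemma phi_section f s : coords f s -> ph (EFin \o f) = map_mx EFin s.
Proof.
move=> fs; apply/rowP => i; have [x _ ->] := phi_attained i fs.
by rewrite [RHS]mxE.
Qed.

Lemma phi_cstNy i : ph (cst -oo%E) 0 i = -oo%E.
Proof.
rewrite mxE; apply: ereal_inf_min; last by move=> y _; rewrite leNye.
by exists 0 => //; rewrite /phi_term theta_bE.
Qed.

Lemma map_EFin_inj : injective (map_mx EFin : 'rV[R]_l -> _).
Proof.
move=> s s' e; apply/rowP => i.
by have := congr1 (fun u : 'rV_l => u 0 i) e; rewrite !mxE => -[].
Qed.

Lemma phi_inj : set_inj sec ph.
Proof.
(* Telling the section [-oo] from finite ones takes at least one coordinate; the class of 0 supplies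
   it. *)
have [i0 _] := b_reps.2 0 (qLam_integral_image S_ext (qLam0 Lam_lattice S_ext)).
have NyE f s : coords f s -> ph (EFin \o f) <> ph (cst -oo%E).
  move=> fs e; have := congr1 (fun u : 'rV_l => u 0 i0) e.
  by rewrite phi_cstNy (phi_section fs) mxE.
move=> h h'; rewrite !inE => -[[f ft <-]|->] [[g gt <-]|->] // e.
- have [s fs] := coords_exist ft; have [s' gs] := coords_exist gt.
  move: e; rewrite (phi_section fs) (phi_section gs) => /map_EFin_inj ss.
  by rewrite (coords_inj ft gt fs) ?ss.
- by have [s /NyE] := coords_exist ft.
- by have [s /NyE] := coords_exist gt; rewrite -e.
Qed.

Lemma phi_image : ph @` (sec `\ cst -oo%E) = map_mx EFin @` coord_set F.
Proof.
apply/seteqP; split=> [_ [h /sections_finiteP[f ft ->] <-]|_ [s sP <-]].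
  have [s fs] := coords_exist ft; exists s; first exact: coords_coord_set fs.
  by rewrite (phi_section fs).
have [f ft fs] := coord_set_coords sP.
by exists (EFin \o f); [apply/sections_finiteP; exists f|exact: phi_section].
Qed.

Lemma shift_classP f h : shift_class (EFin \o f) h <->
  exists t, h = EFin \o (fun x => f x + t).
Proof. by split=> -[t ->]; exists t. Qed.

Lemma shift_class_eq f t :
  shift_class (EFin \o (fun x => f x + t)) = shift_class (EFin \o f).
Proof.
apply/seteqP; split=> h /shift_classP[u ->]; apply/shift_classP.
  by exists (t + u); congr comp; apply/funext => x; rewrite addrA.
by exists (u - t); congr comp; apply/funext => x; ring.
Qed.

Lemma projectivization_coordinates i0 :
  exists psi : set ('rV[R]_n -> \bar R) -> 'rV[R]_l.-1,
  (forall h s, (sec `\ cst -oo%E) h -> ph h = map_mx EFin s ->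
     psi (shift_class h) = proj_coord i0 s) /\
  set_bij (projectivization sec) (proj_coord i0 @` coord_set F) psi.
Proof.
(* [psi] reads the coordinates of an arbitrary member of the class: another member shifts them by a
   constant vector, which [proj_coord] kills. The default of [xget] is never reached on a shift
   class, which is nonempty. *)
pose psi (C : set ('rV[R]_n -> \bar R)) :=
  proj_coord i0 (map_mx fine (ph (xget (cst -oo%E) C))).
have psiE f s : theta f -> coords f s ->
    psi (shift_class (EFin \o f)) = proj_coord i0 s.
  move=> ft fs; rewrite /psi.
  have /shift_classP[t ->] : shift_class (EFin \o f)
      (xget (cst -oo%E) (shift_class (EFin \o f))).
    apply: xgetPex; exists (EFin \o f); apply/shift_classP; exists 0.
    by congr comp; apply/funext => x; rewrite addr0.
  rewrite (phi_section (coordsD_cst t fs)) -(proj_coordD_const i0 s t).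
  by congr proj_coord; apply/rowP => j; rewrite !mxE.
exists psi; split=> [h s /sections_finiteP[f ft ->]|].
  have [s' fs] := coords_exist ft.
  by rewrite (phi_section fs) => /map_EFin_inj <-; exact: psiE.
split.
- move=> _ [h /sections_finiteP[f ft ->] <-]; have [s fs] := coords_exist ft.
  by rewrite (psiE f s)//; exists s => //; exact: coords_coord_set fs.
- move=> C D; rewrite !inE => -[h /sections_finiteP[f ft ->] <-].
  move=> [h' /sections_finiteP[g gt ->] <-].
  have [s fs] := coords_exist ft; have [s' gs] := coords_exist gt.
  rewrite (psiE f s)// (psiE g s')// => /proj_coord_eq; set t := _ - _ => ss.
  rewrite -(shift_class_eq f t); congr (shift_class (EFin \o _)).
  apply: (@coords_inj _ _ s') => //; first exact: theta_functionD_cst.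
  by rewrite ss; exact: coordsD_cst.
- move=> _ [s sP <-]; have [f ft fs] := coord_set_coords sP.
  exists (shift_class (EFin \o f)); last exact: psiE.
  by exists (EFin \o f) => //; apply/sections_finiteP; exists f.
Qed.

End Sections.

Theorem theorem39 (R : realType) (n : nat)
  (Lam : set 'rV[R]_n) (Lam_lattice : is_lattice Lam)
  (Q : 'rV[R]_n -> 'rV[int]_n -> int) (Q_bilinear : zbilinear Lam Q)
  (S : 'M[R]_n) (S_ext : real_extension Lam Q S)
  (S_sym : forall x y, QR S x y = QR S y x)
  (S_psd : forall x, 0 <= QR S x x)
  (alpha : 'rV[R]_n) :
  ((exists r gamma, alpha = qR S r + intv R gamma) ->
   exists l : nat,
     [/\ (Cok_torsion Lam Q #= `I_l)%card,
         exists g : 'I_l -> 'rV[R]_n -> \bar R,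
           generates (sections Lam S alpha) g,
         exists b : 'I_l -> 'rV[int]_n, is_representatives Lam Q S b
       & forall (r : 'rV[R]_n) (gamma : 'rV[int]_n)
           (b : 'I_l -> 'rV[int]_n) (c : 'I_l -> 'rV[R]_n),
           alpha = qR S r + intv R gamma ->
           is_representatives Lam Q S b ->
           (forall i, qR S (c i) = intv R (b i)) ->
           let ph := phi Lam Q S r gamma b c in
           (* the suprema and infima defining [phi] are maxima and minima *)
           [/\ forall i x, exists2 lam, Lam lam &
                 theta_b Lam Q S r (b i) (c i) x
                   = (theta_term Q S r (b i) (c i) x lam)%:E,
               forall f i, finite_sections Lam S alpha f -> exists x,
                 ph f 0 i = phi_term Lam Q S r gamma (b i) (c i) f x,
               set_inj (sections Lam S alpha) ph
             & exists P : set 'rV[R]_l,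
                 [/\ ph @` (sections Lam S alpha `\ cst -oo%E)
                       = map_mx EFin @` P,
                     polyhedron P,
                     affine_dim P l
                   & forall i0 : 'I_l,
                     exists psi : set ('rV[R]_n -> \bar R) -> 'rV[R]_l.-1,
                       [/\ forall f s,
                             (sections Lam S alpha `\ cst -oo%E) f ->
                             ph f = map_mx EFin s ->
                             psi (shift_class f) = proj_coord i0 s,
                           set_bij (projectivization (sections Lam S alpha))
                             (proj_coord i0 @` P) psi,
                           compact (proj_coord i0 @` P)
                         & polyhedron (proj_coord i0 @` P)]]]])
  /\
  (~ (exists r gamma, alpha = qR S r + intv R gamma) ->
   sections Lam S alpha = [set cst -oo%E]).
Proof.
split; last first.
  move=> nalpha; apply/seteqP; split=> [h|h ->]; last by right.
  move=> [[f ft _]|//]; case: nalpha.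
  (* A finite section would have a support at 0, and its integral slope [a] would exhibit [alpha] in
     the image of [qR S] plus an integral covector. *)
  have [a aP] := regular_support 0 ft.1.
  have [y yP] := theta_support_range Lam_lattice S_sym S_psd ft aP.
  by exists y, a; rewrite -yP subrK.
move=> [r0 [gamma0 alphaE0]].
have [l lP [b0 b0P]] := representatives_exist Lam_lattice S_ext.
exists l; split=> //; last 2 first.
- by exists b0.
- move=> r gamma b c alphaE bP cP ph.
  have [F FP] := theta_basis_exists Lam_lattice S_ext S_sym S_psd bP r.
  have Ft i := (FP i).1; have Fm i := (FP i).2.
  split.
  + exact: (theta_b_attained S_ext S_sym Fm cP).
  + move=> _ i [f ft <-].
    have [s fs] := coords_exist Lam_lattice alphaE Ft ft.
    have [x xP _] := phi_attained S_ext S_sym Fm cP i fs.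
    by exists x.
  + exact: (phi_inj Lam_lattice S_ext S_sym S_psd bP alphaE Ft Fm cP).
  have Plin := coord_set_linear_system Lam_lattice S_ext S_sym S_psd bP Ft Fm.
  have [e e0 eP] := coord_set_interior Lam_lattice S_ext S_sym S_psd bP Fm.
  have P0 : coord_set F 0 by apply: eP => i; rewrite mxE normr0 ltW.
  have Pcst s t := @coord_set_const _ _ _ F s t.
  exists (coord_set F); split.
  + exact: (phi_image Lam_lattice S_ext S_sym S_psd bP alphaE Ft Fm cP).
  + by apply: linear_system_polyhedron => //; exists 0.
  + exact: affine_dim_full e0 eP.
  move=> i0.
  have [psi [psi1 psi2]] := projectivization_coordinates Lam_lattice S_ext S_sym S_psd
    bP alphaE Ft Fm cP i0.
  exists psi; split=> //.
  + have [C CP] := basis_difference_bounded Lam_lattice Ft.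
    apply: (proj_coord_compact Plin Pcst (C := C)) => s sP j k.
    exact: coord_set_difference CP sP j k.
  + apply: linear_system_polyhedron (proj_coord_linear_system Plin Pcst i0).
    by exists (proj_coord i0 0); exists 0.
(* For generation, one decomposition of [alpha] and one system of representatives suffice; the
   generators are the resulting [F i] twisted by [gamma0]. *)
have [F FP] := theta_basis_exists Lam_lattice S_ext S_sym S_psd b0P r0.
eexists.
exact: (sections_generated Lam_lattice S_ext S_sym S_psd b0P alphaE0
  (fun i => (FP i).1) (fun i => (FP i).2)).
Qed.
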